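(* Let $D$ be a division ring with infinite center $F$ and let $N$ be a non-central almost subnormal subgroup of $D^*$. If $xy-yx$ is algebraic over $F$ of bounded degree for all $x,y\in N$ (i.e. there is a positive integer $d$ such that for all $x,y\in N$ the element $xy-yx$ is algebraic over $F$ of degree at most $d$), then $D$ is centrally finite.
   Context: $D^*$ is the multiplicative group of $D$. $D$ is centrally finite if it is a finite-dimensional vector space over its center $F$. A subgroup of $D^*$ is non-central if it is not contained in $F$. A subgroup $N$ of a group $G$ is almost subnormal in $G$ if there is a finite series of subgroups $N=N_r\le N_{r-1}\le\cdots\le N_0=G$ such that for each $1\le i\le r$, either $N_i$ is normal in $N_{i-1}$ or $N_i$ has finite index in $N_{i-1}$. *)

(* Defs.v *)
From mathcomp Require Import all_boot all_order all_algebra.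
From mathcomp Require Import boolp classical_sets functions cardinality.

Set Implicit Arguments.
Unset Strict Implicit.
Unset Printing Implicit Defensive.

Import GRing.Theory.
Local Open Scope classical_set_scope.
Local Open Scope ring_scope.

(* [GRing.field_axiom] only says that nonzero elements are units (which are
   two-sided in a [unitRingType]): commutativity is not part of it. *)
Definition division_ring (D : unitRingType) : Prop := GRing.field_axiom D.

Definition center (D : unitRingType) : set D :=
  [set z | forall x : D, z * x = x * z].
Arguments center D : clear implicits.

Definition unit_group (D : unitRingType) : set D :=
  [set x | x \is a GRing.unit].
Arguments unit_group D : clear implicits.

Definition subgroup (D : unitRingType) (H : set D) : Prop :=
  [/\ H `<=` unit_group D,
      H 1,
      (forall x y : D, H x -> H y -> H (x * y))
    & (forall x : D, H x -> H x^-1)].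

Definition normal_in (D : unitRingType) (K H : set D) : Prop :=
  forall k h : D, K k -> H h -> H (k^-1 * h * k).

Definition lcoset (D : unitRingType) (k : D) (H : set D) : set D :=
  [set k * h | h in H].

Definition finite_index_in (D : unitRingType) (K H : set D) : Prop :=
  finite_set [set lcoset k H | k in K].

Definition almost_subnormal (D : unitRingType) (G N : set D) : Prop :=
  exists (r : nat) (S : nat -> set D),
    [/\ S 0%N = G,
        S r = N,
        (forall i : nat, (i <= r)%N -> subgroup (S i))
      & (forall i : nat, (i < r)%N ->
           S i.+1 `<=` S i /\
           (normal_in (S i) (S i.+1) \/ finite_index_in (S i) (S i.+1)))].

(* Evaluation at [a] is unambiguous over the noncommutative ring [D], since
   central coefficients commute with [a]. *)
Definition central_annihilator (D : unitRingType) (a : D) (p : {poly D}) :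
    Prop :=
  (forall i : nat, center D p`_i) /\ p.[a] = 0.

Definition central_min_poly (D : unitRingType) (a : D) (p : {poly D}) : Prop :=
  [/\ p \is monic,
      central_annihilator a p
    & forall q : {poly D},
        q != 0 -> central_annihilator a q -> (size p <= size q)%N].

Definition algebraic_of_degree (D : unitRingType) (a : D) (n : nat) : Prop :=
  exists p : {poly D}, central_min_poly a p /\ size p = n.+1.

(* [D] has a finite basis [e] as a vector space over its center. *)
Definition centrally_finite (D : unitRingType) : Prop :=
  exists (n : nat) (e : 'I_n -> D), forall x : D,
    exists! c : {ffun 'I_n -> D},
      (forall i : 'I_n, center D (c i)) /\ x = \sum_(i < n) c i * e i.

(* Main.v *)
(** Let [a] be a noncentral element of [N] and [F] the
    center.  Rational functions [1 + c t^Q + ...] of a central variable [t] with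
    values in the successive terms of the series show that the leading
    coefficients obtainable in [N] contain the values of an iterated Lie word
    [p_0 = u], [p_(s+1) (u, v) = [p_s u - a (p_s u) a^-1, p_s v]]: a normal step
    yields one bracket, and a step of finite index yields nothing new, by the
    pigeonhole principle applied to functions of different orders.  As [F] is
    infinite, the Capelli-type polynomial that detects algebraicity of degree at
    most [d] thus vanishes at all [[p (u), p (v)]] with [u], [v] in [D], and, by
    the same token, at all operators [u], [v] on [D] spanned by the maps
    [x |-> a x k] with [k] in a maximal commutative subset [K].  If [D] had infinite
    dimension over [F], it would have infinite dimension over [K], and by
    Jacobson density the operators [p (u)] would be arbitrary on finite sets of
    vectors, which contradicts the identity. *)
From HB Require Import structures.
Require Import Defs.
From mathcomp Require Import all_boot all_order all_algebra.
From mathcomp Require Import boolp classical_sets functions cardinality filter.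

Set Implicit Arguments.
Unset Strict Implicit.
Unset Printing Implicit Defensive.

Import GRing.Theory.
Local Open Scope classical_set_scope.
Local Open Scope ring_scope.

(** * Polynomials over a division ring *)

Section CentralRoots.

Variable R : nzRingType.
Implicit Types (p q : {poly R}) (t : R).

Definition central t := forall x : R, t * x = x * t.

Lemma horner_centralM p q t : central t -> (p * q).[t] = p.[t] * q.[t].
Proof. by move=> ct; apply: hornerM_comm; rewrite /comm_poly ct. Qed.

(** Evaluation at central points is multiplicative, so linear factors split off one by one. Right
    inverses of differences are assumed because the lemma also serves in a ring of endomorphisms. *)
Lemma central_roots_seq (rs : seq R) p :
    uniq rs -> {in rs, forall t, central t} ->
    {in rs &, forall s t, s != t -> exists u, (s - t) * u = 1} ->
    {in rs, forall t, p.[t] = 0} -> (size p <= size rs)%N ->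
  p = 0.
Proof.
elim: rs p => [|t rs IH] p /=; first by move=> _ _ _ _;
  rewrite leqn0 size_poly_eq0 => /eqP.
case/andP=> tNrs urs crs drs rrs szp.
have /factor_theorem [q Dp] : root p t by apply/eqP/rrs; rewrite inE eqxx.
have [q0|qN0] := eqVneq q 0; first by rewrite Dp q0 mul0r.
have in_t s : s \in rs -> s \in t :: rs by rewrite inE => ->; rewrite orbT.
rewrite Dp (IH q) ?mul0r //.
- by move=> s /in_t/crs.
- by move=> s s' /in_t s1 /in_t s2; apply: drs.
- move=> s srs; have := rrs _ (in_t _ srs); rewrite Dp horner_centralM;
    last exact/crs/in_t.
  rewrite hornerXsubC => e0.
  have [|||u du] := drs s t; first exact: in_t.
  + by rewrite inE eqxx.
  + by apply: contraNneq tNrs => <-.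
  by rewrite -[LHS]mulr1 -du mulrA e0 mul0r.
- by move: szp; rewrite Dp size_Mmonic ?monicXsubC // size_XsubC addn2.
Qed.

Lemma central_roots_eq0 (T : set R) p :
    infinite_set T -> (forall t, T t -> central t) ->
    (forall s t, T s -> T t -> s != t -> exists u, (s - t) * u = 1) ->
    (forall t, T t -> p.[t] = 0) ->
  p = 0.
Proof.
move=> infT cT dT rT.
have [B sBT szB] := infinite_set_fset (size p) infT.
have inT s : s \in finmap.enum_fset B -> T s by move=> sB; apply: sBT.
apply: (@central_roots_seq (finmap.enum_fset B)) => //.
- exact: finmap.fset_uniq.
- by move=> t /inT; apply: cT.
- by move=> s t /inT Ts /inT Tt; apply: dT.
- by move=> t /inT; apply: rT.
Qed.

End CentralRoots.

Section DivisionRing.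

Variables (D : unitRingType) (hD : division_ring D).
Implicit Types (A B p q : {poly D}) (x y : D).

Lemma div_mulVr x : x != 0 -> x^-1 * x = 1.
Proof. by move=> /hD; apply: mulVr. Qed.

Lemma div_mulrV x : x != 0 -> x * x^-1 = 1.
Proof. by move=> /hD; apply: mulrV. Qed.

Lemma div_mul_neq0 x y : x != 0 -> y != 0 -> x * y != 0.
Proof.
move=> x0 y0; apply: contra_neq y0 => xy0.
by rewrite -[y]mul1r -(div_mulVr x0) -mulrA xy0 mulr0.
Qed.

Lemma centerV x : center D x -> center D x^-1.
Proof.
move=> cx y; have [->|x0] := eqVneq x 0; first by rewrite invr0 mul0r mulr0.
by rewrite -[LHS]mulr1 -(div_mulrV x0) -mulrA (mulrA y) -cx !mulrA div_mulVr ?mul1r.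
Qed.

Lemma div_poly_mul_neq0 p q : p != 0 -> q != 0 -> p * q != 0.
Proof.
move=> p0 q0.
have lpq : lead_coef p * lead_coef q != 0 by apply: div_mul_neq0;
  rewrite lead_coef_eq0.
by rewrite -lead_coef_eq0 lead_coef_proper_mul.
Qed.

Lemma size_sub_lead A B : B != 0 -> A != 0 -> (size B <= size A)%N ->
  (size (A - B * (((lead_coef B)^-1 * lead_coef A)%:P
                    * 'X^(size A - size B)))%R < size A)%N.
Proof.
move=> B0 A0 szBA; set c := _ * lead_coef A; set k := (_ - _)%N.
have sA : (0 < size A)%N by rewrite lt0n size_poly_eq0.
have sB : (0 < size B)%N by rewrite lt0n size_poly_eq0.
rewrite -[X in (_ < X)%N](prednK sA) ltnS; apply/leq_sizeP => j.
rewrite leq_eqVlt => /orP[/eqP <-|lj]; rewrite coefB mulrA coefMXn coefMC.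
- have -> : ((size A).-1 < k)%N = false.
    by apply/negbTE; rewrite -leqNgt /k -subn1 leq_sub2l.
  have -> : ((size A).-1 - k = (size B).-1)%N.
    by rewrite /k -!subn1 subnAC subKn.
  by rewrite -!lead_coefE /c mulrA div_mulrV ?lead_coef_eq0 // mul1r subrr.
- have lj' : (size A <= j)%N by rewrite -(prednK sA).
  rewrite nth_default // sub0r; case: ifP => _; first by rewrite oppr0.
  rewrite (nth_default _ (_ : (size B <= j - k)%N)) ?mul0r ?oppr0 //.
  by rewrite /k leq_subRL ?subnK // (leq_trans (leq_subr _ _)).
Qed.

(** The right Ore condition, by the Euclidean algorithm: the larger of [A] and [B] is reduced by a
    right multiple of the other. *)
Lemma poly_ore A B : B != 0 -> exists A' B', B' != 0 /\ A * B' = B * A'.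
Proof.
have [n] := ubnP (size A + size B)%N; elim: n A B => // n IH A B;
  rewrite ltnS => szAB B0.
have [A0|A0] := eqVneq A 0.
  by exists 0, 1; rewrite oner_neq0 A0 mul0r mulr0.
have [szBA|/ltnW szBA] := leqP (size B) (size A).
- have := size_sub_lead B0 A0 szBA; set M := _%:P * _ => lt_sz.
  have [|A' [B' [B'0 e]]] := IH (A - B * M) B _ B0.
    by apply: (leq_trans _ szAB); rewrite ltn_add2r.
  exists (A' + M * B'), B'; split=> //.
  by rewrite mulrDr -e mulrBl mulrA subrK.
- have := size_sub_lead A0 B0 szBA; set M := _%:P * _ => lt_sz.
  have [BM|BM] := eqVneq (B - A * M) 0.
    exists 1, M; rewrite mulr1; split; last by rewrite -[RHS](subrK (A * M)) BM add0r.
    by apply: contra_neq B0 => M0; rewrite -[B](subrK (A * M)) BM M0 mulr0 addr0.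
  have [|A' [B' [B'0 e]]] := IH A (B - A * M) _ BM.
    by apply: (leq_trans _ szAB); rewrite ltn_add2l.
  exists A', (B' + M * A'); split; last by rewrite mulrDr e mulrBl mulrA subrK.
  apply: contra_neq B'0 => BA0.
  have : B * A' == 0 by rewrite -(subrK (A * M) B) mulrDl -e -mulrA -mulrDr BA0 mulr0.
  have [A'0|A'0] := eqVneq A' 0; last by rewrite (negbTE (div_poly_mul_neq0 B0 A'0)).
  by move=> _; apply: contra_eq e => ?; rewrite A'0 mulr0 div_poly_mul_neq0.
Qed.

Lemma coef0_eq0_mulX p : p`_0 = 0 -> exists q, p = q * 'X.
Proof.
move=> p0; have /factor_theorem [q ->] : root p 0 by rewrite /root horner_coef0 p0.
by exists q; rewrite polyC0 subr0.
Qed.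

(** The Ore condition localized at ['X]: if [B'] vanishes at 0 then so does [A'], and a common
    factor ['X] cancels. It makes fractions with denominator nonzero at 0 stable under sum and
    product. *)
Lemma local_ore A B : B`_0 != 0 ->
  exists A' B', B'`_0 != 0 /\ A * B' = B * A'.
Proof.
move=> B00; have B0 : B != 0 by apply: contra_neq B00 => ->; rewrite coef0.
have [A' [B' [B'0 e]]] := poly_ore A B0.
have [n] := ubnP (size B'); elim: n A' B' B'0 e => // n IH A' B' B'0 e szB.
have [B'00|] := eqVneq B'`_0 0; last by exists A', B'.
have A'00 : A'`_0 = 0.
  have /eqP := congr1 (fun p : {poly D} => p`_0) e.
  rewrite !coef0M B'00 mulr0 eq_sym; apply: contraTeq => ?.
  exact: div_mul_neq0.
have [A'' DA] := coef0_eq0_mulX A'00; have [B'' DB] := coef0_eq0_mulX B'00.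
have B''0 : B'' != 0 by apply: contra_neq B'0 => B''0; rewrite DB B''0 mul0r.
apply: (IH A'' B'' B''0).
- by apply: (monic_rreg (monicX D)); rewrite /= -!mulrA -DA -DB.
- by move: szB; rewrite DB size_mulX // ltnS.
Qed.

End DivisionRing.

(** * Leading coefficients of rational functions of a central variable *)

Section Limits.

Variables (D : unitRingType) (hD : division_ring D) (U : set_system D).
Hypotheses (UF : ProperFilter U) (UZ : U (center D))
  (Ucofin : forall A : set D, finite_set A -> U (~` A)).
Implicit Types (f g : D -> D) (c : D).

(* [f t = A(t) B(t)^-1] for almost all central [t], with [B(0) != 0]: such an
   [f] extends to [t = 0] with value [c = A(0) B(0)^-1]. *)
Definition Lim f c := exists A B : {poly D},
  [/\ B`_0 != 0, A`_0 = c * B`_0 & U [set t | f t * B.[t] = A.[t]]].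

Lemma poly_almost_neq0 (p : {poly D}) : p != 0 -> U [set t | p.[t] != 0].
Proof.
move=> p0; have fin : finite_set [set t | center D t /\ p.[t] = 0].
  apply: contra_neqP p0 => infT.
  apply: (central_roots_eq0 infT) => [t [] //|s t [cs _] [ct _] st|t [] //].
  by exists (s - t)^-1; rewrite div_mulrV // subr_eq0.
apply: filterS (filterI UZ (Ucofin fin)) => t [ct nt] /=.
by apply/eqP => pt; apply: nt.
Qed.

Lemma coef0_neq0 (p : {poly D}) : p`_0 != 0 -> p != 0.
Proof. by apply: contra_neq => ->; rewrite coef0. Qed.

(** This carries identities from almost all [t] to the value at 0: for [c] nonzero, [A] would be a
    nonzero polynomial vanishing almost everywhere. *)
Lemma Lim_eq0 f c : Lim f c -> U [set t | f t = 0] -> c = 0.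
Proof.
move=> [A [B [B0 A0 fAB]]] f0; apply/eqP; apply: contraT => cN0.
have AN0 : A != 0 by apply: coef0_neq0; rewrite A0; apply: div_mul_neq0.
have [t [[/= e ft] At]] := filter_ex (filterI (filterI fAB f0) (poly_almost_neq0
  AN0)).
by move: At; rewrite /= -e ft mul0r eqxx.
Qed.

Lemma Lim_near f g c : U [set t | f t = g t] -> Lim f c -> Lim g c.
Proof.
move=> fg [A [B [B0 A0 fAB]]]; exists A, B; split=> //.
by apply: filterS (filterI fg fAB) => t [/= <-].
Qed.

Lemma Lim_poly (p : {poly D}) : Lim (fun t => p.[t]) p`_0.
Proof.
exists p, 1; rewrite coef1 /= mulr1; split; rewrite ?oner_neq0 //.
by apply: filterS UZ => t _ /=; rewrite hornerC mulr1.
Qed.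

Lemma Lim_cst c : Lim (fun=> c) c.
Proof.
have := Lim_poly c%:P; rewrite coefC /=; apply: Lim_near.
by apply: filterS UZ => t _ /=; rewrite hornerC.
Qed.

Lemma Lim_exp n : (0 < n)%N -> Lim (fun t => t ^+ n) 0.
Proof.
move=> n0; have := Lim_poly 'X^n; rewrite coefXn; case: n n0 => // n _ /=.
by apply: Lim_near; apply: filterS UZ => t _ /=; rewrite hornerXn.
Qed.

Lemma LimD f g c c' : Lim f c -> Lim g c' -> Lim (fun t => f t + g t) (c + c').
Proof.
move=> [A [B [B0 A0 fAB]]] [A' [B' [B'0 A'0 gAB]]].
(* [B C = B' C'] is a common denominator. *)
have [C' [C [C0 e]]] := local_ore hD B B'0.
have C'0 : C'`_0 != 0.
  have := congr1 (fun p : {poly D} => p`_0) e; rewrite !coef0M => e0.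
  have : B`_0 * C`_0 != 0 by apply: div_mul_neq0.
  by apply: contra_neq => C'0; rewrite e0 C'0 mulr0.
exists (A * C + A' * C'), (B * C); split.
- by rewrite coef0M div_mul_neq0.
- rewrite coefD !coef0M A0 A'0 mulrDl -!mulrA; congr (_ + c' * _).
  by rewrite -!coef0M e.
apply: filterS (filterI UZ (filterI fAB gAB)) => t [ct [/= fe ge]].
rewrite hornerD mulrDl {2}e !horner_centralM // !mulrA.
by rewrite fe ge.
Qed.

Lemma LimM f g c c' : Lim f c -> Lim g c' -> Lim (fun t => f t * g t) (c * c').
Proof.
move=> [A [B [B0 A0 fAB]]] [A' [B' [B'0 A'0 gAB]]].
(* Formally [B^-1 A' = C' C^-1], so the product is [A C'] over [B' C]. *)
have [C' [C [C0 e]]] := local_ore hD A' B0.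
exists (A * C'), (B' * C); split.
- by rewrite coef0M div_mul_neq0.
- rewrite !coef0M A0 -!mulrA; congr (c * _).
  by rewrite mulrA -A'0 -!coef0M e.
apply: filterS (filterI UZ (filterI fAB gAB)) => t [ct [/= fe ge]].
rewrite !horner_centralM // -fe -!mulrA; congr (f t * _).
by rewrite mulrA ge -!horner_centralM // e.
Qed.

Lemma LimN f c : Lim f c -> Lim (fun t => - f t) (- c).
Proof.
move=> /(LimM (Lim_cst (-1))); rewrite mulN1r; apply: Lim_near.
by apply: filterS UZ => t _ /=; rewrite mulN1r.
Qed.

Lemma LimB f g c c' : Lim f c -> Lim g c' -> Lim (fun t => f t - g t) (c - c').
Proof. by move=> lf /LimN; apply: LimD. Qed.

Lemma LimX f c n : Lim f c -> Lim (fun t => f t ^+ n) (c ^+ n).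
Proof.
move=> lf; elim: n => [|n IH].
  by rewrite expr0; apply: Lim_near (Lim_cst 1); apply: filterS UZ => t _ /=;
    rewrite expr0.
rewrite exprS; apply: Lim_near (LimM lf IH).
by apply: filterS UZ => t _ /=; rewrite exprS.
Qed.

Lemma Lim_almost_neq0 f c : Lim f c -> c != 0 -> U [set t | f t != 0].
Proof.
move=> [A [B [B0 A0 fAB]]] c0.
have AN0 : A != 0 by apply: coef0_neq0; rewrite A0; apply: div_mul_neq0.
apply: filterS (filterI fAB (poly_almost_neq0 AN0)) => t [/= fe].
by apply: contra_neq => ft; rewrite -fe ft mul0r.
Qed.

Lemma LimV f c : c != 0 -> Lim f c -> Lim (fun t => (f t)^-1) c^-1.
Proof.
move=> c0 lf; have f0 := Lim_almost_neq0 lf c0.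
have [A [B [B0 A0 fAB]]] := lf.
exists B, A; split.
- by rewrite A0 div_mul_neq0.
- by rewrite A0 mulrA div_mulVr // mul1r.
by apply: filterS (filterI fAB f0) => t [/= <- ft]; rewrite mulrA div_mulVr // mul1r.
Qed.

Lemma Lim_one_plus f c n : (0 < n)%N -> Lim f c -> Lim (fun t => 1 + t ^+ n * f t) 1.
Proof.
move=> n0 lf; rewrite -[X in Lim _ X](addr0 1) -[X in _ + X](mul0r c).
by apply: LimD (Lim_cst 1) (LimM (Lim_exp n0) lf).
Qed.

End Limits.

(** * Lie words and a Capelli-type polynomial *)

Section Identities.

Variable R : nzRingType.
Implicit Types (a b x y r : R) (rs es : seq R).

Definition lie x y := x * y - y * x.
(** [b] stands for the inverse of [a]; as a separate argument it can be transported to rings without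
    an inverse operation. *)
Definition ldelta a b x := x - a * x * b.

(* Variables are indexed by the words over [bool], so that the two subterms of
   a bracket never share a variable. *)
Fixpoint lieword a b (s : nat) (u : seq bool -> R) : R :=
  if s is s'.+1 then
    lie (ldelta a b (lieword a b s' (fun l => u (true :: l))))
        (lieword a b s' (fun l => u (false :: l)))
  else u [::].

(** An elimination in place of the alternating Capelli sum: the pivot [e] is removed by the map
    [x |-> x r e - e r x], which is linear over the center and kills [e]. It is meant for [es] one
    longer than [rs]. *)
Fixpoint capelli rs es : R :=
  if rs is r :: rs' then
    if es is e :: es' then capelli rs' [seq x * r * e - e * r * x | x <- es']
    else 0
  else head 0 es.

Definition powers d x := [seq x ^+ i | i <- iota 0 d.+1].

End Identities.

Section Morphisms.

Variables (R S : nzRingType) (f : {rmorphism R -> S}).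

Lemma lieword_morph a b s u :
  f (lieword a b s u) = lieword (f a) (f b) s (fun l => f (u l)).
Proof.
by elim: s u => //= s IH u; rewrite /lie /ldelta !(rmorphB, rmorphM) /= !IH.
Qed.

Lemma capelli_morph rs es : f (capelli rs es) = capelli (map f rs) (map f es).
Proof.
elim: rs es => [|r rs IH] [|e es] //=; rewrite ?rmorph0 // IH.
congr capelli; rewrite -!map_comp; apply: eq_map => x /=.
by rewrite rmorphB !rmorphM.
Qed.

Lemma powers_morph d x : map f (powers d x) = powers d (f x).
Proof. by rewrite /powers -map_comp; apply: eq_map => i /=; rewrite rmorphXn. Qed.

End Morphisms.

Section CapelliDivision.

Variables (D : unitRingType) (hD : division_ring D).

Definition dependent (es : seq D) := exists c : nat -> D,
  [/\ forall i, center D (c i), exists2 i, (i < size es)%N & c i != 0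
    & \sum_(i < size es) c i * es`_i = 0].

(** The elimination map drops the term of the pivot from a relation and keeps the other
    coefficients. If these are all zero, the pivot itself is 0 and the next list consists of
    zeros. *)
Lemma capelli_dependent (rs es : seq D) :
  size es = (size rs).+1 -> dependent es -> capelli rs es = 0.
Proof.
elim: rs es => [|r rs IH] [|e es] //= [sz] [c [cc [i /= i_lt ci] sum0]].
  case: es sz i_lt sum0 => // _ i_lt; rewrite big_ord_recl big_ord0 addr0 /=.
  have -> : c 0%N = c i by case: i i_lt {ci}.
  by move/eqP; apply: contraTeq => e0; apply: div_mul_neq0.
apply: IH; first by rewrite size_map sz.
set es' := map _ es; have szes' : size es' = size es by rewrite size_map.
rewrite big_ord_recl /= in sum0.
have nth' j : (j < size es)%N -> es'`_j = es`_j * r * e - e * r * es`_j.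
  by move=> j_lt; rewrite (nth_map 0).
have [[j j_lt cj]|none] := pselect (exists2 j, (j < size es)%N & c j.+1 != 0).
  exists (fun j => c j.+1); split=> //; first by exists j; rewrite ?szes'.
  rewrite szes'.
  transitivity ((\sum_(i < size es) c i.+1 * es`_i) * (r * e)
                - e * r * (\sum_(i < size es) c i.+1 * es`_i)).
    rewrite mulr_suml mulr_sumr -sumrB; apply: eq_bigr => k _.
    by rewrite nth' // mulrBr [e * r * (_ * _)]mulrA -(cc k.+1 (e * r)) !mulrA.
  have -> : \sum_(i < size es) c i.+1 * es`_i = - (c 0%N * e).
    by apply/eqP; rewrite -addr_eq0 addrC; apply/eqP.
  by rewrite mulrN !mulNr opprK [e * r * (_ * _)]mulrA -(cc 0%N (e * r)) !mulrA addNr.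
have c0 j : (j < size es)%N -> c j.+1 = 0.
  by move=> j_lt; apply/eqP; apply: contraT => cj; case: none; exists j.
have e0 : e = 0.
  move: sum0; rewrite big1 => [|k _]; last by rewrite c0 // mul0r.
  rewrite addr0 => /eqP; apply: contraTeq => e0; apply: div_mul_neq0 => //.
  by case: i i_lt ci => // i; rewrite ltnS => /c0 ->; rewrite eqxx.
exists (fun=> 1); split=> [k x|| ].
- by rewrite mul1r mulr1.
- by exists 0%N; rewrite ?oner_neq0 // szes' sz.
by rewrite szes' big1 // => k _; rewrite nth' // e0 mulr0 !mul0r subrr mulr0.
Qed.

Lemma center_exp t n : center D t -> center D (t ^+ n).
Proof. by move=> ct x; rewrite -/(GRing.comm (t ^+ n) x);
  apply/commr_sym/commrX/commr_sym/ct. Qed.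

(** The central factor [T] is absorbed into the coefficients of the minimal polynomial; [T] will be
    a power of [t]. *)
Lemma powers_dependent d n (T e : D) :
    center D T -> T != 0 -> (n <= d)%N -> algebraic_of_degree (T * e) n ->
  dependent (powers d e).
Proof.
move=> cT T0 nd [p [[pm [pc pr] _] szp]].
have TX i : T ^+ i != 0 by elim: i => [|i IH];
  rewrite ?oner_neq0 // exprS div_mul_neq0.
exists (fun i => p`_i * T ^+ i); rewrite size_map size_iota; split.
- by move=> i x; rewrite -mulrA (center_exp i cT) mulrA (pc i) mulrA.
- exists n => //; have := monicP pm; rewrite lead_coefE szp /= => ->.
  by rewrite mul1r.
rewrite -[RHS]pr (horner_coef_wide _ (_ : (size p <= d.+1)%N)) ?szp //.
apply: eq_bigr => i _; rewrite (nth_map 0%N) ?size_iota // nth_iota // add0n.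
by rewrite -mulrA exprMn_comm // /GRing.comm cT.
Qed.

End CapelliDivision.

(** * Leading coefficients along an almost subnormal series *)

Section Chain.

Variables (D : unitRingType) (hD : division_ring D) (U : set_system D).
Hypotheses (UU : UltraFilter U) (UZ : U (center D))
  (Ucofin : forall A : set D, finite_set A -> U (~` A)).
Implicit Types (H K : set D) (c : D).

Let UF : ProperFilter U := ultra_proper.
Local Notation Lim := (Lim U).

Lemma Lim_capelli rs (s : seq nat) (E : nat -> D -> D) (c : nat -> D) :
  (forall i, Lim (E i) (c i)) ->
  Lim (fun t => capelli rs [seq E i t | i <- s]) (capelli rs [seq c i | i <- s]).
Proof.
elim: rs s E c => [|r rs IH] [|i0 s] E c lE //=; try exact: Lim_cst.
have := IH s (fun i t => E i t * r * E i0 t - E i0 t * r * E i t)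
             (fun i => c i * r * c i0 - c i0 * r * c i).
rewrite -map_comp; under [X in _ -> Lim X _]funext => t do rewrite -map_comp.
apply=> i; have lr : Lim (fun=> r) r by apply: Lim_cst.
by apply: LimB => //; apply: LimM => //; apply: LimM.
Qed.

(* [c] is a leading coefficient at [1], of arbitrarily high order, of a
   rational function of [t] with values in [H]. *)
Definition leading H c := forall B : nat, exists Q X,
  [/\ (B < Q)%N, Lim X c & U [set t | H (1 + t ^+ Q * X t)]].

Lemma leading_unit c : leading (unit_group D) c.
Proof.
move=> B; exists B.+1, (fun=> c); split=> //; first exact: Lim_cst.
have l1 : Lim (fun t => 1 + t ^+ B.+1 * c) 1.
  by apply: Lim_one_plus => //; apply: Lim_cst.
have : U [set t | 1 + t ^+ B.+1 * c != 0] by apply: Lim_almost_neq0 l1 (oner_neq0 D).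
by apply: filterS => t; apply: hD.
Qed.

(** With [x = 1 + T X], the commutator minus 1 is [(x y - y x) x^-1 y^-1], and the central [T]
    factors out of [x y - y x]. *)
Lemma commutator_expand (T X y : D) :
    center D T -> 1 + T * X \is a GRing.unit -> y \is a GRing.unit ->
  (1 + T * X) * y * (1 + T * X)^-1 * y^-1
    = 1 + T * ((X * y - y * X) * ((1 + T * X)^-1 * y^-1)).
Proof.
move=> cT xU yU; set x := 1 + T * X.
have -> : T * ((X * y - y * X) * (x^-1 * y^-1)) = (x * y - y * x) * (x^-1 * y^-1).
  rewrite mulrA; congr (_ * _);
    rewrite /x [(1 + _) * y]mulrDl [y * (1 + _)]mulrDr mul1r mulr1 mulrBr.
  by rewrite opprD addrACA subrr add0r !mulrA -(cT y).
have yx1 : y * x * (x^-1 * y^-1) = 1 by rewrite mulrA mulrK // divrr.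
by rewrite mulrBl yx1 addrC subrK !mulrA.
Qed.

(** For [x], [y] in [H] with leading coefficients [c], [c'], normality puts [w = x a x^-1 a^-1] in
    [K], and then [w y w^-1 y^-1] as well. The first has leading coefficient [c - a c a^-1], the
    second its bracket with [c']. *)
Lemma leading_normal H K (a c c' : D) :
    subgroup H -> subgroup K -> K `<=` H -> normal_in H K -> K a ->
    leading H c -> leading H c' ->
  leading K (lie (ldelta a a^-1 c) c').
Proof.
move=> [HU H1 HM HV] [KU K1 KM KV] KH nK Ka lc lc' B.
have [Q [X [BQ LX HX]]] := lc B; have [Q' [Y [BQ' LY HY]]] := lc' B.
have Q0 : (0 < Q)%N by case: (Q) BQ. have Q'0 : (0 < Q')%N by case: (Q') BQ'.
have aU := KU _ Ka.
pose x t := 1 + t ^+ Q * X t; pose y t := 1 + t ^+ Q' * Y t.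
pose W t := (X t * a - a * X t) * ((x t)^-1 * a^-1).
pose w t := 1 + t ^+ Q * W t.
have Lx : Lim x 1 by apply: Lim_one_plus LX.
have Ly : Lim y 1 by apply: Lim_one_plus LY.
have La b : Lim (fun=> b) b by apply: Lim_cst.
have Lxv : Lim (fun t => (x t)^-1) 1.
  by rewrite -invr1; apply: LimV => //; apply: oner_neq0.
have Lyv : Lim (fun t => (y t)^-1) 1.
  by rewrite -invr1; apply: LimV => //; apply: oner_neq0.
have LW : Lim W (ldelta a a^-1 c).
  have -> : ldelta a a^-1 c = (c * a - a * c) * (1 * a^-1).
    by rewrite mul1r mulrBl mulrK.
  by apply: LimM => //; [apply: LimB => //; apply: LimM|apply: LimM].
have Lw : Lim w 1 by apply: Lim_one_plus LW.
have Lwv : Lim (fun t => (w t)^-1) 1.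
  by rewrite -invr1; apply: LimV => //; apply: oner_neq0.
exists (Q + Q')%N, (fun t => (W t * Y t - Y t * W t) * ((w t)^-1 * (y t)^-1)); split.
- by rewrite (leq_trans BQ) ?leq_addr.
- rewrite -[lie _ _]mulr1 -[X in _ * X](mulr1 1).
  by apply: LimM => //; [apply: LimB => //; apply: LimM|apply: LimM].
apply: filterS (filterI UZ (filterI HX HY)) => t [ct [/= Hx Hy]].
have cQ := center_exp Q ct; have cQ' := center_exp Q' ct.
have Kw : K (w t).
  rewrite /w /W /x -commutator_expand //; last exact: HU.
  apply: KM; last exact: KV.
  by have := nK _ _ (HV _ Hx) Ka; rewrite invrK.
have -> : 1 + t ^+ (Q + Q') * ((W t * Y t - Y t * W t) * ((w t)^-1 * (y t)^-1))
   = w t * y t * (w t)^-1 * (y t)^-1.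
  have := commutator_expand cQ (KU _ Kw) (HU _ Hy); rewrite -/(w t) -/(y t) => ->.
  have -> : W t * y t - y t * W t = t ^+ Q' * (W t * Y t - Y t * W t).
    rewrite /y; move: (W t) => z.
    rewrite [z * (1 + _)]mulrDr [(1 + _) * z]mulrDl mulr1 mul1r opprD addrACA subrr
      add0r mulrBr.
    by rewrite !mulrA -(cQ' z).
  move: (W t * Y t - Y t * W t) (w t) (y t) => z z1 z2.
  by rewrite exprD !mulrA.
rewrite -!mulrA; apply: KM => //.
by have := nK _ _ (HV _ Hy) (KV _ Kw); rewrite invrK mulrA.
Qed.

(** This is where the ultrafilter property enters: among finitely many cosets, one serves almost all
    [t]. *)
Lemma ultra_seq (T : eqType) (s : seq T) (P : T -> set D) :
  U [set t | exists2 C, C \in s & P C t] -> exists2 C, C \in s & U (P C).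
Proof.
elim: s => [|C s IH] Us; first by have [t []] := filter_ex Us.
have [PC|nPC] := in_ultra_setVsetC (P C) UU.
  by exists C => //; rewrite inE eqxx.
have [|C' C's UC'] := IH; last by exists C' => //; rewrite inE C's orbT.
apply: filterS (filterI Us nPC) => t [[C']]; rewrite inE => /orP[/eqP-> //|C's PC'] _.
by exists C'.
Qed.

Lemma pigeonhole_frequently (T : eqType) (s : seq T) (P : nat -> T -> Prop) :
  (forall B : nat, exists2 Q, (B < Q)%N & exists2 C, C \in s & P Q C) ->
  exists2 C, C \in s & forall B : nat, exists2 Q, (B < Q)%N & P Q C.
Proof.
elim: s => [|C s IH] PB; first by have [Q _ []] := PB 0%N.
have [PC|nPC] := pselect (forall B : nat, exists2 Q, (B < Q)%N & P Q C).
  by exists C => //; rewrite inE eqxx.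
have [B0 nB0] := (existsNP _).2 nPC.
have [|C' C's PC'] := IH; last by exists C' => //; rewrite inE C's orbT.
move=> B; have [Q] := PB (maxn B B0); rewrite gtn_max => /andP[BQ B0Q] [C'].
rewrite inE => /orP[/eqP->|C's] PQ; first by case: nB0; exists Q.
by exists Q => //; exists C'.
Qed.

(* Two functions of different orders in the same coset: the quotient has the
   leading coefficient of the one of smaller order. *)
Lemma leading_finite_index H K c :
    subgroup H -> K `<=` H -> finite_index_in H K -> leading H c -> subgroup K ->
  leading K c.
Proof.
move=> [HU _ _ _] KH /finite_seqP [s Ds] lc [_ K1 _ _].
pose P Q C := exists2 X, Lim X c &
  U [set t | H (1 + t ^+ Q * X t) /\ lcoset (1 + t ^+ Q * X t) K = C].
have [|C _ PC] := @pigeonhole_frequently _ s P.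
  move=> B; have [Q [X [BQ LX HX]]] := lc B; exists Q => //.
  have [|C Cs UC] := @ultra_seq _ s
    (fun C t => H (1 + t ^+ Q * X t) /\ lcoset (1 + t ^+ Q * X t) K = C).
    apply: filterS HX => t Ht; exists (lcoset (1 + t ^+ Q * X t) K) => //.
    have : [set lcoset k K | k in H] (lcoset (1 + t ^+ Q * X t) K) by exists (1 + t
      ^+ Q * X t).
    by rewrite Ds.
  by exists C => //; exists X.
move=> B; have [Q BQ [X LX HX]] := PC B; have [Q' QQ' [Y LY HY]] := PC Q.
have Q0 : (0 < Q)%N by case: (Q) BQ. have Q'0 : (0 < Q')%N by case: (Q') QQ'.
have Lyv : Lim (fun t => (1 + t ^+ Q' * Y t)^-1) 1.
  by rewrite -[X in Lim _ X]invr1; apply: LimV => //;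
    [apply: oner_neq0|apply: Lim_one_plus LY].
exists Q, (fun t => (1 + t ^+ Q' * Y t)^-1 * (X t - t ^+ (Q' - Q) * Y t)); split=> //.
  rewrite -[c]mul1r -[X in 1 * X]subr0 -[X in _ - X](mul0r c).
  apply: LimM => //; apply: LimB => //; apply: LimM => //.
  by apply: Lim_exp => //; rewrite subn_gt0.
apply: filterS (filterI UZ (filterI HX HY)) => t [ct [/= [Hx Cx] [Hy Cy]]].
have [h Kh Dx] : lcoset (1 + t ^+ Q' * Y t) K (1 + t ^+ Q * X t).
  by rewrite Cy -Cx; exists 1; rewrite ?mulr1.
suff -> : 1 + t ^+ Q * ((1 + t ^+ Q' * Y t)^-1 * (X t - t ^+ (Q' - Q) * Y t)) = h
  by [].
have yU := HU _ Hy; have cQ := center_exp Q ct.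
rewrite mulrA cQ -mulrA mulrBr mulrA -exprD subnKC ?(ltnW QQ') //.
move: Dx; set y := 1 + t ^+ Q' * Y t; set x := 1 + t ^+ Q * X t => Dx.
have -> : t ^+ Q * X t - t ^+ Q' * Y t = x - y by rewrite opprD addrACA subrr add0r.
by rewrite mulrBr mulVr // addrC subrK -Dx mulrA mulVr // mul1r.
Qed.

(** Induction along the series, starting from [unit_group D], where every coefficient is leading. A
    normal step raises [s] by one, a step of finite index keeps it. *)
Lemma leading_lieword (N : set D) (a : D) :
    almost_subnormal (unit_group D) N -> N a ->
  exists s, forall u, leading N (lieword a a^-1 s u).
Proof.
move=> [r [S [S0 Sr Sg Sn]]] Na.
have Sa i : (i <= r)%N -> S i a.
  move=> ir; rewrite -(subKn ir); elim: (r - i)%N (leq_subr i r) => [|k IH] kr.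
    by rewrite subn0 Sr.
  have rk : (r - k.+1 < r)%N by rewrite ltn_subrL (leq_ltn_trans _ kr).
  have [sub _] := Sn _ rk; apply: sub; rewrite -subSn // subSS; exact: IH (ltnW kr).
rewrite -Sr; elim: {-2}r (leqnn r) => [|i IH] ir.
  by exists 0%N => u; rewrite S0; apply: leading_unit.
have [s IHs] := IH (ltnW ir); have [sub [nS|fS]] := Sn _ ir.
- exists s.+1 => u; apply: (leading_normal (H := S i)) => //; try exact: Sa;
    try exact: Sg.
  exact/Sg/ltnW.
- exists s => u; apply: (leading_finite_index (H := S i)) => //; try exact: Sg.
  exact/Sg/ltnW.
Qed.

(** For [x = 1 + t^Q X] and [y = 1 + t^Q' Y] in [N], one has [x y - y x = t^(Q+Q') lie X Y]. So the
    powers of [lie X Y] are dependent and [capelli] vanishes for almost all [t], hence at the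
    limit. *)
Lemma capelli_lieword (N : set D) (a : D) (d s : nat) u u' rs :
    (forall x y, N x -> N y -> exists n : nat,
       (n <= d)%N /\ algebraic_of_degree (x * y - y * x) n) ->
    leading N (lieword a a^-1 s u) -> leading N (lieword a a^-1 s u') ->
    size rs = d ->
  capelli rs (powers d (lie (lieword a a^-1 s u) (lieword a a^-1 s u'))) = 0.
Proof.
move=> algN /(_ 0%N)[Q [X [_ LX HX]]] /(_ 0%N)[Q' [Y [_ LY HY]]] szrs.
have Le : Lim (fun t => lie (X t) (Y t)) (lie (lieword a a^-1 s u) (lieword a a^-1
  s u')).
  by apply: LimB => //; apply: LimM.
pose e t := lie (X t) (Y t).
have Lpow i : Lim (fun t => e t ^+ i) (lie (lieword a a^-1 s u) (lieword a a^-1 s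
  u') ^+ i).
  by apply: LimX.
apply: (Lim_eq0 hD UF UZ Ucofin (Lim_capelli rs (iota 0 d.+1) Lpow)).
have U0 : U [set t | t != 0].
  apply: filterS (Ucofin (finite_set1 0)) => t /= nt; exact/eqP.
apply: filterS (filterI (filterI UZ U0) (filterI HX HY)) => t [[ct /= t0] [/= Nx Ny]].
apply: (@capelli_dependent _ hD rs (powers d (e t))).
  by rewrite size_map size_iota szrs.
have [n [nd alg]] := algN _ _ Nx Ny.
have tX i : t ^+ i != 0 by elim: i => [|i IH];
  rewrite ?oner_neq0 // exprS div_mul_neq0.
apply: (powers_dependent hD (center_exp (Q + Q') ct) (tX _) nd).
suff -> : t ^+ (Q + Q') * lie (X t) (Y t) = (1 + t ^+ Q * X t) * (1 + t ^+ Q' * Y t)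
   - (1 + t ^+ Q' * Y t) * (1 + t ^+ Q * X t) by [].
have cQ := center_exp Q ct; have cQ' := center_exp Q' ct.
rewrite /lie exprD.
move: (X t) (Y t) (t ^+ Q) (t ^+ Q') cQ cQ' => x y q q' cq cq'.
have com : (1 + q * x) * (1 + q' * y) - (1 + q' * y) * (1 + q * x)
   = q * x * (q' * y) - q' * y * (q * x).
  have expand z z' : (1 + z) * (1 + z') = 1 + z + z' + z * z'.
    by rewrite mulrDl mul1r mulrDr mulr1 addrA (addrAC 1 z').
  by rewrite !expand (addrAC 1 (q' * y)) opprD addrACA subrr add0r.
rewrite com mulrBr; congr (_ - _).
  by rewrite -!mulrA; congr (_ * _); rewrite !mulrA cq'.
by rewrite cq -!mulrA; congr (_ * _); rewrite !mulrA cq.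
Qed.

End Chain.

(** * The density theorem *)

Section Density.

Variables (D : unitRingType) (hD : division_ring D) (K : set D).
Hypotheses (K1 : K 1) (KM : forall x y, K x -> K y -> K (x * y)).
Implicit Types (T S : D -> D) (W : seq D) (l : seq (D * D)) (a b c v w z : D).

Definition opsum l v := \sum_(x <- l) x.1 * v * x.2.

(** Two cases are used below: a maximal commuting [K], which is its own commutant, and [setT], whose
    commutant is the center. *)
Definition operator T := exists l,
  (forall x, x \in l -> K x.2) /\ forall v, T v = opsum l v.

Definition commutant c := forall k, K k -> c * k = k * c.

Lemma opsumD l v w : opsum l (v + w) = opsum l v + opsum l w.
Proof.
by rewrite /opsum -big_split; apply: eq_bigr => x _; rewrite mulrDr mulrDl.
Qed.

Lemma opsumMr l v c : (forall x, x \in l -> K x.2) -> commutant c ->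
  opsum l (v * c) = opsum l v * c.
Proof.
move=> lK cc; rewrite /opsum mulr_suml big_seq [RHS]big_seq;
  apply: eq_bigr => x /lK xK.
by rewrite -!mulrA cc.
Qed.

Lemma operatorD T v w : operator T -> T (v + w) = T v + T w.
Proof. by move=> [l [_ TE]]; rewrite !TE opsumD. Qed.

Lemma operator0 T : operator T -> T 0 = 0.
Proof. by move=> /(operatorD 0 0); rewrite addr0 => /eqP;
  rewrite addrC -subr_eq subrr => /eqP. Qed.

Lemma operatorN T v : operator T -> T (- v) = - T v.
Proof. by move=> oT; apply/eqP; rewrite -addr_eq0 -operatorD // addNr operator0. Qed.

Lemma operatorB T v w : operator T -> T (v - w) = T v - T w.
Proof. by move=> oT; rewrite operatorD // operatorN. Qed.

Lemma operatorMr T v c : operator T -> commutant c -> T (v * c) = T v * c.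
Proof. by move=> [l [lK TE]] cc; rewrite !TE opsumMr. Qed.

Lemma operator_eq T S : T =1 S -> operator T -> operator S.
Proof. by move=> TS [l [lK TE]]; exists l; split=> // v; rewrite -TS TE. Qed.

Lemma operator_mulr k : K k -> operator (fun v => v * k).
Proof.
move=> Kk; exists [:: (1, k)]; split=> [x|v]; first by rewrite inE => /eqP->.
by rewrite /opsum big_seq1 mul1r.
Qed.

Lemma operator_mull a : operator (fun v => a * v).
Proof.
exists [:: (a, 1)]; split=> [x|v]; first by rewrite inE => /eqP->.
by rewrite /opsum big_seq1 mulr1.
Qed.

Lemma operator_id : operator id.
Proof. by apply: operator_eq (operator_mull 1) => v; rewrite mul1r. Qed.

Lemma operator_add T S : operator T -> operator S -> operator (fun v => T v + S v).
Proof.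
move=> [l [lK TE]] [l' [lK' SE]]; exists (l ++ l'); split=> [x|v].
  by rewrite mem_cat => /orP[/lK|/lK'].
by rewrite /opsum big_cat TE SE.
Qed.

Lemma operator_comp T S : operator T -> operator S -> operator (T \o S).
Proof.
move=> [l [lK TE]] [l' [lK' SE]].
exists [seq (x.1 * y.1, y.2 * x.2) | x <- l, y <- l']; split=> [x|v].
  by move=> /allpairsP[[p q] [/= /lK ? /lK' ? ->]]; apply: KM.
rewrite /opsum big_allpairs_dep /= TE; apply: eq_bigr => x _.
rewrite SE mulr_sumr mulr_suml; apply: eq_bigr => y _.
by rewrite !mulrA.
Qed.

Lemma operator_opp T : operator T -> operator (fun v => - T v).
Proof.
move=> oT; apply: operator_eq (operator_comp (operator_mull (-1)) oT) => v /=.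
by rewrite mulN1r.
Qed.

Lemma operator_lmul a T : operator T -> operator (fun v => a * T v).
Proof. exact: (operator_comp (operator_mull a)). Qed.

(* By the density theorem this is the span of [W] over the commutant of [K]
   acting on the right; defining it as a double annihilator makes one half of
   the density theorem hold by definition. *)
Definition rspan W z := forall T,
  operator T -> (forall w, w \in W -> T w = 0) -> T z = 0.

Lemma rspan_mem W z : z \in W -> rspan W z.
Proof. by move=> zW T _; apply. Qed.

Lemma rspan_nil z : rspan [::] z -> z = 0.
Proof. by move=> /(_ _ operator_id); apply. Qed.

Lemma rspanD W z z' : rspan W z -> rspan W z' -> rspan W (z + z').
Proof. by move=> cz cz' T oT TW; rewrite operatorD // cz // cz' // addr0. Qed.

Lemma rspanN W z : rspan W z -> rspan W (- z).
Proof. by move=> cz T oT TW; rewrite operatorN // cz // oppr0. Qed.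

Lemma rspanB W z z' : rspan W z -> rspan W z' -> rspan W (z - z').
Proof. by move=> cz /rspanN; apply: rspanD. Qed.

Lemma rspan0 W : rspan W 0.
Proof. by move=> T oT _; apply: operator0. Qed.

Lemma rspanMr W z c : commutant c -> rspan W z -> rspan W (z * c).
Proof. by move=> cc cz T oT TW; rewrite operatorMr // cz // mul0r. Qed.

Lemma rspan_sub W W' z :
  (forall w, w \in W -> rspan W' w) -> rspan W z -> rspan W' z.
Proof. by move=> WW' cz T oT TW'; apply: cz => // w /WW'; apply. Qed.

Lemma rspan_subset W W' z : {subset W <= W'} -> rspan W z -> rspan W' z.
Proof. by move=> sub; apply: rspan_sub => w /sub/rspan_mem. Qed.

Lemma rspan_lmul a W z : rspan W z -> rspan [seq a * w | w <- W] (a * z).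
Proof.
move=> cz T oT TW; apply: (cz (T \o [eta *%R a])).
  exact: operator_comp oT (operator_mull a).
by move=> w wW; apply: TW; apply: map_f.
Qed.

Lemma operator_separate W z : ~ rspan W z ->
  exists T, [/\ operator T, forall w, w \in W -> T w = 0 & T z = 1].
Proof.
move=> /existsNP[T /not_implyP[oT /not_implyP[TW /eqP Tz]]].
exists (fun v => (T z)^-1 * T v); split; first exact: operator_lmul.
  by move=> w wW; rewrite (TW w wW) mulr0.
by rewrite div_mulVr.
Qed.

Lemma commutantV c : commutant c -> commutant c^-1.
Proof.
move=> cc k Kk; have [->|c0] := eqVneq c 0; first by rewrite invr0 mul0r mulr0.
by rewrite -[LHS]mulr1 -(div_mulrV hD c0) -mulrA (mulrA k) -cc // !mulrA div_mulVr
  ?mul1r.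
Qed.

Lemma commutantB c c' : commutant c -> commutant c' -> commutant (c - c').
Proof. by move=> cc cc' k Kk; rewrite mulrBl mulrBr cc ?cc'. Qed.

Lemma commutant0 : commutant 0.
Proof. by move=> k _; rewrite mul0r mulr0. Qed.

(** The core of the density theorem. If [T] kills [W] and [T w = 1], every [S] killing [W] satisfies
    [S z = S w * T z]. Taking for [S] the map [T] followed by right multiplication by [k] shows that
    [T z] commutes with [k]; it is the coefficient of [w]. *)
Lemma rspan_cons w W z : rspan (w :: W) z ->
  exists c, commutant c /\ rspan W (z - w * c).
Proof.
move=> cz; have [cw|/operator_separate [T [oT TW Tw]]] := pselect (rspan W w).
  exists 0; split; first exact: commutant0.
  rewrite mulr0 subr0; apply: rspan_sub cz => w'.
  by rewrite inE => /orP[/eqP-> //|]; apply: rspan_mem.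
have Sz S : operator S -> (forall w', w' \in W -> S w' = 0) -> S z = S w * T z.
  move=> oS SW; apply/eqP; rewrite -subr_eq0; apply/eqP.
  apply: (cz (fun v => S v - S w * T v)).
    by apply: operator_add oS _; apply: operator_opp; apply: operator_lmul.
  move=> w'; rewrite inE => /orP[/eqP->|w'W]; first by rewrite Tw mulr1 subrr.
  by rewrite SW // TW // mulr0 subrr.
have cT : commutant (T z).
  move=> k Kk; have := Sz (fun v => T v * k); rewrite Tw mul1r; apply.
    exact: operator_comp (operator_mulr Kk) oT.
  by move=> w' /TW ->; rewrite mul0r.
exists (T z); split=> // S oS SW.
by rewrite operatorB // operatorMr // (Sz S) // subrr.
Qed.

Lemma rspan_unscale W z c : commutant c -> c != 0 -> rspan W (z * c) -> rspan W z.
Proof.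
move=> cc c0 /(rspanMr (commutantV cc)).
by rewrite -mulrA div_mulrV ?mulr1.
Qed.

Lemma extend_operator T W z c : operator T -> ~ rspan W z ->
  exists S, [/\ operator S, forall w, w \in W -> S w = T w & S z = c].
Proof.
move=> oT /operator_separate [S [oS SW Sz]].
exists (fun v => T v + (c - T z) * S v); split.
- by apply: operator_add => //; apply: operator_lmul.
- by move=> w /SW ->; rewrite mulr0 addr0.
- by rewrite Sz mulr1 addrC subrK.
Qed.

(** Independence of the [y i] is stated as the freedom to prescribe an operator on them, the form in
    which density is applied. *)
Lemma rspan_basis W : exists n (y : nat -> D),
  (forall f : nat -> D, exists T, operator T /\ forall i, (i < n)%N -> T (y i) = f i)
  /\ forall w, w \in W -> rspan (mkseq y n) w.
Proof.
elim: W => [|w W [n [y [dy cy]]]].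
  by exists 0%N, (fun=> 0); split=> // f; exists id; split=> //; apply: operator_id.
have [cw|ncw] := pselect (rspan (mkseq y n) w).
  by exists n, y; split=> // w'; rewrite inE => /orP[/eqP->|/cy].
exists n.+1, (fun i => if (i < n)%N then y i else w); split=> [f|].
  have [T [oT Ty]] := dy f.
  have [S [oS Sy Sw]] := extend_operator (f n) oT ncw.
  exists S; split=> // i; rewrite ltnS leq_eqVlt => /orP[/eqP->|lin].
    by rewrite ltnn.
  by rewrite lin Sy ?Ty // map_f // mem_iota.
have sub : {subset mkseq y n <= mkseq (fun i => if (i < n)%N then y i else w) n.+1}.
  move=> x /mapP[i]; rewrite mem_iota /= add0n => lin ->.
  by apply/mapP; exists i; rewrite ?lin // mem_iota /= add0n ltnW.
move=> w'; rewrite inE => /orP[/eqP->|/cy]; last exact: rspan_subset.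
apply: rspan_mem; apply/mapP; exists n; rewrite ?ltnn // mem_iota /=.
by rewrite add0n ltnS.
Qed.

Section Fresh.

Variable b : D.
Hypotheses (b_noncentral : ~ center D b) (infdim : forall W, exists z, ~ rspan W z).

(* Otherwise [b] would act as a scalar modulo a finite-dimensional subspace,
   and a nonzero commutator of [b] would have finite rank. *)
Lemma fresh_vector W : exists z, ~ rspan W z /\ ~ rspan (z :: W) (b * z).
Proof.
apply: contrapT => nofresh.
have scal z : ~ rspan W z -> exists c, commutant c /\ rspan W (b * z - z * c).
  move=> ncz; apply: rspan_cons; apply: contrapT => ncbz.
  by apply: nofresh; exists z.
have [z1 nz1] := infdim W; have [z2 nz2] := infdim (z1 :: W).
have [c [cc cz1]] := scal _ nz1.
have clW z : rspan W z -> rspan (z1 :: W) z.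
  by apply: rspan_subset => w wW; rewrite inE wW orbT.
have cl1 x : commutant x -> rspan (z1 :: W) (z1 * x).
  by move=> cx; apply: rspanMr => //; apply: rspan_mem; rewrite inE eqxx.
(* The scalars of [z], [z1] and [z + z1] must agree, as otherwise [z] and [z1] would be dependent
   modulo [W]. *)
have out z : ~ rspan (z1 :: W) z -> rspan W (b * z - z * c).
  move=> nz; have [|c' [cc' cz]] := scal z; first by move=> /clW.
  have [|c'' [cc'' czz]] := scal (z + z1).
    move=> /clW cl; apply: nz; rewrite -(addrK z1 z); apply: rspanB => //.
    by apply: rspan_mem; rewrite inE eqxx.
  have cl : rspan W (z * (c' - c'') + z1 * (c - c'')).
    have -> : z * (c' - c'') + z1 * (c - c'')
       = (b * (z + z1) - (z + z1) * c'') - (b * z - z * c') - (b * z1 - z1 * c).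
      rewrite !mulrBr mulrDr mulrDl !opprB addrACA -opprD -[RHS]addrA.
      by rewrite [X in _ = _ + X]addrACA -opprD [RHS]addrC addrA subrK.
    by apply: rspanB => //; apply: rspanB.
  have [e1|ne1] := eqVneq c' c''; last first.
    case: nz; apply: (rspan_unscale (commutantB cc' cc'')); first by rewrite subr_eq0.
    rewrite -(addrK (z1 * (c - c'')) (z * _)); apply: rspanB; first exact: clW.
    by apply: cl1; apply: commutantB.
  have [e2|ne2] := eqVneq c c''; first by rewrite e2 -e1.
  case: nz1; apply: (rspan_unscale (commutantB cc cc'')); first by rewrite subr_eq0.
  by move: cl; rewrite e1 subrr mulr0 add0r.
(* A vector inside the span of [z1 :: W] is the difference of [z + z2] and [z2], both outside. *)
have all z : rspan W (b * z - z * c).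
  have [cz|nz] := pselect (rspan (z1 :: W) z); last exact: out.
  have -> : b * z - z * c = (b * (z + z2) - (z + z2) * c) - (b * z2 - z2 * c).
    by rewrite mulrDr mulrDl [- (z * c + _)]opprD addrACA addrK.
  apply: rspanB; apply: out => // cl; apply: nz2.
  by rewrite -(addrK z z2) [z2 + z]addrC; apply: rspanB.
have [d nd] : exists d, b * d != d * b.
  by apply: contrapT => nd; apply: b_noncentral => d; apply/eqP;
    apply: contraT => h; case: nd; exists d.
(* Modulo the span of [W], [b] acts as right multiplication by [c], which commutes with left
   multiplication by [d]. So [e] maps [D] into the span of [W2], and dividing by [e] contradicts
   infinite dimension. *)
pose e := d * b - b * d.
have e0 : e != 0 by rewrite subr_eq0 eq_sym.
pose W2 := [seq d * w | w <- W] ++ W.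
have cle z : rspan W2 (e * z).
  have -> : e * z = d * (b * z - z * c) - (b * (d * z) - (d * z) * c).
    by rewrite /e mulrBl mulrBr !mulrA opprB addrA subrK.
  apply: rspanB.
    by move: (rspan_lmul (a := d) (all z)); apply: rspan_subset => w wW;
      rewrite mem_cat wW.
  by move: (all (d * z)); apply: rspan_subset => w wW; rewrite mem_cat wW orbT.
have [z []] := infdim [seq e^-1 * w | w <- W2].
by have := rspan_lmul (a := e^-1) (cle z); rewrite mulrA div_mulVr // mul1r.
Qed.

Lemma fresh_density W : exists z : nat -> D, forall n (f g : nat -> D),
  exists T, [/\ operator T, forall w, w \in W -> T w = 0,
    forall i, (i < n)%N -> T (z i) = f i
  & forall i, (i < n)%N -> T (b * z i) = g i].
Proof.
have [s Ps] := choice fresh_vector.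
(* Each new vector is fresh for [W], the earlier vectors and their images under [b]. *)
pose L := fix L n := if n is n'.+1 then b * s (L n') :: s (L n') :: L n' else W.
have subL w : w \in W -> forall n, w \in L n.
  by move=> wW; elim=> //= n IH; rewrite !inE IH !orbT.
have inL i n : (i < n)%N -> s (L i) \in L n /\ b * s (L i) \in L n.
  elim: n => // n IH; rewrite ltnS leq_eqVlt => /orP[/eqP->|/IH []] /=.
    by rewrite !inE !eqxx !orbT.
  by rewrite !inE => -> ->; rewrite !orbT.
exists (fun i => s (L i)) => n f g; elim: n => [|n [T [oT TW Tf Tg]]].
  by exists (fun=> 0); split=> //; exists [::]; split=> // v; rewrite /opsum big_nil.
have [nc1 nc2] := Ps (L n).
have [T1 [oT1 T1L T1z]] := extend_operator (f n) oT nc1.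
have [T2 [oT2 T2L T2z]] := extend_operator (g n) oT1 nc2.
have T2E w : w \in L n -> T2 w = T w.
  by move=> wL; rewrite T2L ?T1L // inE wL orbT.
exists T2; split=> //.
- by move=> w wW; rewrite T2E ?TW //; apply: subL.
- move=> i; rewrite ltnS leq_eqVlt => /orP[/eqP->|lin].
    by rewrite T2L ?T1z // inE eqxx.
  by rewrite T2E ?Tf //; apply: (inL _ _ lin).1.
- move=> i; rewrite ltnS leq_eqVlt => /orP[/eqP-> //|lin].
  by rewrite T2E ?Tg //; apply: (inL _ _ lin).2.
Qed.

End Fresh.

End Density.

(** * Descent to the center *)

Section CentralSpan.

Variables (D : unitRingType) (hD : division_ring D).
Implicit Types (W : seq D) (z : D).

Local Notation span := (@rspan D setT).

Let T1 : @setT D 1. Proof. by []. Qed.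
Let TM (x y : D) : @setT D x -> @setT D y -> @setT D (x * y). Proof. by []. Qed.

Lemma commutant_setT c : commutant setT c <-> center D c.
Proof. by split=> [cc x|cc x _]; apply: cc. Qed.

Lemma span_coord W z : span W z -> exists c : nat -> D,
  (forall i, center D (c i)) /\ z = \sum_(i < size W) c i * W`_i.
Proof.
elim: W z => [|w W IH] z.
  move=> /(rspan_nil T1) ->; exists (fun=> 0); split=> [i x|].
    by rewrite mul0r mulr0.
  by rewrite big_ord0.
move=> /(rspan_cons hD T1 TM) [c [/commutant_setT cc /IH [c' [cc' e]]]].
exists (fun i => if i is j.+1 then c' j else c); split=> [[|i] //|].
by rewrite big_ord_recl /= -e cc addrC subrK.
Qed.

Lemma span_lmul W z c : center D c -> span W z -> span W (c * z).
Proof. by move=> cc; rewrite cc; apply: rspanMr; apply/commutant_setT. Qed.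

(** A spanning list of minimal length is a basis: two distinct coordinate vectors of [x] would make
    some entry redundant. *)
Lemma span_centrally_finite W : (forall z, span W z) -> centrally_finite D.
Proof.
move=> spW; pose P n := `[< exists W', size W' = n /\ forall z, span W' z >].
have exP : exists n, P n by exists (size W); apply/asboolP; exists W.
case: (ex_minnP exP) => n /asboolP [{spW}{}W [szW spW]] minn.
exists n, (fun i => W`_i) => x.
have [c [cc Dx]] := span_coord (spW x); rewrite szW in Dx.
exists [ffun i : 'I_n => c i]; split.
  split=> [i|]; first by rewrite ffunE.
  by rewrite {1}Dx; apply: eq_bigr => i _; rewrite ffunE.
move=> c' [cc' Dx']; apply/ffunP => j; rewrite ffunE; apply/eqP.
rewrite -subr_eq0; apply: contraT => cj.
pose W' := map (fun i : 'I_n => W`_i) (enum (predC1 j)).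
have szW' : (size W' < n)%N.
  by rewrite size_map -cardE cardC1 card_ord ltn_predL (leq_ltn_trans _ (ltn_ord j)).
suff /minn : P (size W') by rewrite leqNgt szW'.
apply/asboolP; exists W'; split=> // z; apply: rspan_sub (spW z) => w wW.
have inW' (i : 'I_n) : i != j -> span W' W`_i.
  by move=> ij; apply/rspan_mem/map_f; rewrite mem_enum.
have ccB (i : 'I_n) : center D (c i - c' i) by move=> y; rewrite mulrBl mulrBr cc cc'.
have [i iW <-] := nthP 0 wW; rewrite szW in iW.
have [ij|] := eqVneq (Ordinal iW) j; last exact: inW'.
have -> : W`_i = W`_j by rewrite -ij.
have -> : W`_j = (c j - c' j)^-1 * ((c j - c' j) * W`_j).
  by rewrite mulrA div_mulVr // mul1r.
apply: span_lmul; first exact: centerV.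
have : \sum_(i < n) (c i - c' i) * W`_i = 0.
  rewrite (eq_bigr (fun i : 'I_n => c i * W`_i - c' i * W`_i)) => [|k _];
    last by rewrite mulrBl.
  by rewrite sumrB -Dx' -Dx subrr.
rewrite (bigD1 j) //= => /eqP; rewrite addr_eq0 => /eqP ->.
apply: rspanN; elim/big_rec: _ => [|k y kj cy]; first exact: rspan0.
by apply: rspanD => //; apply: span_lmul => //; apply: inW'.
Qed.

End CentralSpan.

(** By Zorn's lemma. Such a [K] equals its commutant, so the right scalars for [rspan K] are the
    elements of [K]. *)
Lemma maximal_commuting (D : unitRingType) : exists K : set D,
  (forall x y, K x -> K y -> x * y = y * x) /\ (forall c, commutant K c -> K c).
Proof.
pose P (K : set D) := forall x y, K x -> K y -> x * y = y * x.
have [|K [PK maxK]] := @Zorn_bigcup D P.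
  move=> C CP totC x y [A CA Ax] [B CB By].
  have [AB|BA] := totC _ _ CA CB.
  - by apply: (CP _ CB) => //; apply: AB.
  - by apply: (CP _ CA) => //; apply: BA.
exists K; split=> // c cc.
have sub : K `<=` K `|` [set c] by move=> x; left.
have Pc : P (K `|` [set c]).
  move=> x y [Kx|->] [Ky|->] //; [exact: PK|by rewrite cc|exact: cc].
apply: contrapT => nKc; apply: (maxK (K `|` [set c])) => //.
split=> // sub'; apply: nKc; apply: sub'; by right.
Qed.

Section FiniteDescent.

Variables (D : unitRingType) (hD : division_ring D) (K : set D).
Hypotheses (Kcomm : forall x y, K x -> K y -> x * y = y * x)
  (Kmax : forall c, commutant K c -> K c).
Implicit Types (l : seq (D * D)) (W : seq D).

Local Notation span := (@rspan D setT).

Let T1 : @setT D 1. Proof. by []. Qed.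
Let TM (x y : D) : @setT D x -> @setT D y -> @setT D (x * y). Proof. by []. Qed.

Lemma max_commutant c : K c -> commutant K c.
Proof. by move=> Kc k; apply: Kcomm. Qed.

Lemma max_center c : center D c -> K c.
Proof. by move=> cc; apply: Kmax => k _; apply: cc. Qed.

Lemma max1 : K 1.
Proof. by apply: max_center => x; rewrite mul1r mulr1. Qed.

Lemma maxM x y : K x -> K y -> K (x * y).
Proof.
by move=> Kx Ky; apply: Kmax => k Kk;
  rewrite -mulrA (Kcomm Ky) // mulrA (Kcomm Kx) // mulrA.
Qed.

Lemma maxD x y : K x -> K y -> K (x + y).
Proof. by move=> Kx Ky; apply: Kmax => k Kk;
  rewrite mulrDl mulrDr (Kcomm Kx) ?(Kcomm Ky). Qed.

Lemma opsum_cons x l v : opsum (x :: l) v = x.1 * v * x.2 + opsum l v.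
Proof. by rewrite /opsum big_cons. Qed.

(** With [a = a1 c + a'] and [c] central, [a1 v (c k)] joins the term of [a1] and [a' v k] goes into
    the tail: no term is added. *)
Lemma opsum_absorb l a k :
    (forall x, x \in l -> K x.2) -> K k -> span (map fst l) a ->
  exists l', [/\ size l' = size l, forall x, x \in l' -> K x.2
    & forall v, opsum l' v = a * v * k + opsum l v].
Proof.
elim: l a => [|[a1 k1] l IH] a lK Kk.
  move=> /(rspan_nil T1) ->; exists [::]; split=> // v.
  by rewrite !mul0r add0r.
move=> /(rspan_cons hD T1 TM) [c [/commutant_setT cc /IH]].
case=> // [x xl|l' [szl' lK' E]]; first by apply: lK; rewrite inE xl orbT.
exists ((a1, k1 + c * k) :: l'); split=> /= [|x|v]; first by rewrite szl'.
  rewrite inE => /orP[/eqP->|/lK'//] /=; apply: maxD.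
    by apply: (lK (a1, k1)); rewrite inE eqxx.
  by apply: maxM => //; apply: max_center.
have e : a1 * v * (c * k) = a1 * c * v * k.
  by rewrite !mulrA -[a1 * v * c]mulrA -cc mulrA.
rewrite !opsum_cons /= E mulrDr !mulrBl e.
by rewrite addrA addrACA subrr addr0 addrAC addrC.
Qed.

Lemma opsum_reduce l : (forall x, x \in l -> K x.2) ->
  (forall v, opsum l v = 0) \/
  exists a k l', [/\ k != 0, (forall x, x \in l' -> K x.2), ~ span (map fst l') a
    & forall v, opsum l v = opsum ((a, k) :: l') v].
Proof.
have [n] := ubnP (size l); elim: n l => // n IH [|[a k] l] /= szl lK.
  by left=> v; rewrite /opsum big_nil.
have lK' x : x \in l -> K x.2 by move=> xl; apply: lK; rewrite inE xl orbT.
have Kk : K k by apply: (lK (a, k)); rewrite inE eqxx.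
have [k0|k0] := eqVneq k 0.
  have E v : opsum ((a, k) :: l) v = opsum l v by rewrite opsum_cons k0 mulr0 add0r.
  have [|z|[a' [k' [l' [? ? ? E']]]]] := IH l _ lK'; first exact: szl.
    by left=> v; rewrite E.
  by right; exists a', k', l'; split=> // v; rewrite E.
have [sa|nsa] := pselect (span (map fst l) a); last first.
  by right; exists a, k, l.
have [l1 [szl1 l1K E]] := opsum_absorb lK' Kk sa.
have [|z|[a' [k' [l' [? ? ? E']]]]] := IH l1 _ l1K; first by rewrite szl1.
  by left=> v; rewrite opsum_cons -E.
by right; exists a', k', l'; split=> // v; rewrite opsum_cons -E.
Qed.

(** Entries are dropped until the rest no longer spans [D]. An operator that kills this rest, scaled
    to be 1 at the last dropped vector [w], reads off the coefficient of [w], an element of [K]. *)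
Lemma finite_functional W : (forall z, rspan K W z) ->
  exists T, [/\ operator K T, exists w, T w != 0 & forall v, K (T v)].
Proof.
elim: W => [|w W IH] clW.
  by have := rspan_nil max1 (clW 1) => /eqP; rewrite oner_eq0.
have [/IH //|/existsNP [z nz]] := pselect (forall z, rspan K W z).
have [T [oT TW Tz]] := operator_separate hD max1 maxM nz.
have Tw : T w != 0.
  apply/eqP => Tw; have /eqP : T z = 0.
    by apply: clW oT _ => w'; rewrite inE => /orP[/eqP->|/TW].
  by rewrite Tz oner_eq0.
exists (fun v => (T w)^-1 * T v); split.
- by apply: operator_lmul oT; [exact: max1|exact: maxM].
- by exists w; rewrite div_mulVr // oner_neq0.
move=> v; have [c [cc /(_ T oT TW)]] := rspan_cons hD max1 maxM (clW v).
rewrite (operatorB _ _ oT) (operatorMr _ oT cc) => /eqP; rewrite subr_eq0 => /eqP ->.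
by rewrite mulrA div_mulVr // mul1r; apply: Kmax.
Qed.

(* The functional [T v = \sum a_l v k_l] commutes with [K] on both sides; after
   isolating [a_1], this writes [k_1 c], for [c] in [K], in terms of the [k_l]. *)
Lemma finite_maximal_commuting W : (forall z, rspan K W z) ->
  exists ks, forall c, K c -> span ks c.
Proof.
move=> /finite_functional [T [[l [lK TE]] [w Tw] TK]].
have [z|[a [k [l' [k0 lK' nsa E]]]]] := opsum_reduce lK.
  by rewrite TE z eqxx in Tw.
(* [S] acts on the left coefficients: it sends [a] to 1 and those of [l'] to 0. *)
have [S [[s [_ SE]] Sl' Sa]] := operator_separate hD T1 TM nsa.
exists [seq k^-1 * x | x <- [seq x.2 | x <- (a, k) :: l']] => c Kc.
rewrite -[c]mul1r -(div_mulVr hD k0) -mulrA; apply: rspan_lmul => //.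
have rep v : v * (k * c) = opsum [seq (S (c * x.1), x.2) | x <- (a, k) :: l'] v.
  (* Expanded directly, this sum keeps only the term of [a]; expanded after moving [c] to the left
     of the [K]-valued [T], it gives the right-hand side. *)
  transitivity (\sum_(x <- s) x.1 * (T (x.2 * v) * c)).
    under eq_bigr => x _ do rewrite TE E /opsum mulr_suml mulr_sumr.
    rewrite exchange_big /= big_cons /=.
    have Sx y : \sum_(i <- s) i.1 * (y.1 * (i.2 * v) * y.2 * c) = S y.1 * v * y.2 * c.
      by rewrite SE /opsum !mulr_suml; apply: eq_bigr => i _; rewrite !mulrA.
    rewrite (Sx (a, k)) /= Sa mul1r big_seq big1 => [|y yl'];
      first by rewrite addr0 mulrA.
    by rewrite Sx Sl' ?mul0r //; apply: map_f.
  under eq_bigr => x _ do rewrite -(Kcomm Kc (TK _)) TE E /opsum !mulr_sumr.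
  rewrite exchange_big /opsum [RHS]big_map; apply: eq_bigr => y _ /=.
  by rewrite SE /opsum !mulr_suml; apply: eq_bigr => i _; rewrite !mulrA.
(* By [rep], an operator killing all right coefficients also kills [k * c]. *)
move=> S' [s' [_ SE']] S'k; rewrite SE' /opsum.
under eq_bigr => x _ do rewrite rep /opsum mulr_suml.
rewrite exchange_big big_map big_seq big1 // => y yl /=.
transitivity (S (c * y.1) * S' y.2).
  by rewrite SE' /opsum mulr_sumr; apply: eq_bigr => i _; rewrite !mulrA.
by rewrite S'k ?mulr0 // map_f.
Qed.

(** The tower argument: [W] spans [D] over [K], and [ks] spans [K] over the center. *)
Lemma finite_centrally_finite W : (forall z, rspan K W z) -> centrally_finite D.
Proof.
move=> clW; have [ks Kks] := finite_maximal_commuting clW.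
apply: (@span_centrally_finite _ hD [seq w * k | w <- W, k <- ks]) => z.
move: (clW z) => {clW}; elim: W z => [|w W IH] z;
  first by move=> /(rspan_nil max1)->; apply: rspan0.
move=> /(rspan_cons hD max1 maxM) [c [/Kmax/Kks cc /IH cl]].
rewrite -(subrK (w * c) z); apply: rspanD.
  move: cl; apply: rspan_subset => x xl.
  by rewrite /= mem_cat xl orbT.
have := rspan_lmul T1 TM (a := w) cc; apply: rspan_subset => x xl.
by rewrite /= mem_cat xl.
Qed.

End FiniteDescent.

(** * Extension of the identity to operators *)

(** In this ring, right multiplications by elements of a commuting [K] are central, so they may be
    substituted for an indeterminate. *)
Record kend (D : unitRingType) (K : set D) := Kend {
  kfun :> D -> D;
  kfunD : forall v w, kfun (v + w) = kfun v + kfun w;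
  kfunM : forall v k, K k -> kfun (v * k) = kfun v * k }.

Local Obligation Tactic := idtac.

Section KendRing.

Variables (D : unitRingType) (K : set D).
Local Notation C := (kend K).
Implicit Types (f g h : C).

Lemma kend_eq f g : f =1 g -> f = g.
Proof.
case: f g => [f fD fM] [g gD gM] /= /funext fg; move: fD fM gD gM; rewrite fg.
by move=> fD fM gD gM; congr Kend; apply: Prop_irrelevance.
Qed.

HB.instance Definition _ := gen_eqMixin C.
HB.instance Definition _ := gen_choiceMixin C.

Program Definition kend0 : C := @Kend D K (fun=> 0) _ _.
Next Obligation. by move=> v w /=; rewrite addr0. Qed.
Next Obligation. by move=> v k _ /=; rewrite mul0r. Qed.

Program Definition kend_opp f : C := @Kend D K (fun v => - f v) _ _.
Next Obligation. by move=> f v w /=; rewrite kfunD opprD. Qed.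
Next Obligation. by move=> f v k Kk /=; rewrite kfunM // mulNr. Qed.

Program Definition kend_add f g : C := @Kend D K (fun v => f v + g v) _ _.
Next Obligation. by move=> f g v w /=; rewrite !kfunD addrACA. Qed.
Next Obligation. by move=> f g v k Kk /=; rewrite !kfunM // mulrDl. Qed.

Program Definition kend1 : C := @Kend D K id _ _.
Next Obligation. by []. Qed.
Next Obligation. by []. Qed.

Program Definition kend_mul f g : C := @Kend D K (f \o g) _ _.
Next Obligation. by move=> f g v w /=; rewrite !kfunD. Qed.
Next Obligation. by move=> f g v k Kk /=; rewrite !kfunM. Qed.

Lemma kend_addA : associative kend_add.
Proof. by move=> f g h; apply: kend_eq => v /=; rewrite addrA. Qed.

Lemma kend_addC : commutative kend_add.
Proof. by move=> f g; apply: kend_eq => v /=; rewrite addrC. Qed.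

Lemma kend_add0 : left_id kend0 kend_add.
Proof. by move=> f; apply: kend_eq => v /=; rewrite add0r. Qed.

Lemma kend_addN : left_inverse kend0 kend_opp kend_add.
Proof. by move=> f; apply: kend_eq => v /=; rewrite addNr. Qed.

HB.instance Definition _ :=
  GRing.isZmodule.Build C kend_addA kend_addC kend_add0 kend_addN.

Lemma kend_mulA : associative kend_mul.
Proof. by move=> f g h; apply: kend_eq. Qed.

Lemma kend_mul1l : left_id kend1 kend_mul.
Proof. by move=> f; apply: kend_eq. Qed.

Lemma kend_mul1r : right_id kend1 kend_mul.
Proof. by move=> f; apply: kend_eq. Qed.

Lemma kend_mulDl : left_distributive kend_mul kend_add.
Proof. by move=> f g h; apply: kend_eq. Qed.

Lemma kend_mulDr : right_distributive kend_mul kend_add.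
Proof. by move=> f g h; apply: kend_eq => v /=; rewrite kfunD. Qed.

Lemma kend_1neq0 : kend1 != 0 :> C.
Proof.
apply/eqP => /(congr1 (fun f : C => f 1)) /= /eqP.
by rewrite (oner_eq0 D).
Qed.

HB.instance Definition _ := GRing.Zmodule_isNzRing.Build C
  kend_mulA kend_mul1l kend_mul1r kend_mulDl kend_mulDr kend_1neq0.

Lemma kendBE f g v : (f - g) v = f v - g v. Proof. by []. Qed.
Lemma kendME f g v : (f * g) v = f (g v). Proof. by []. Qed.

Lemma kend_sumE I (r : seq I) (P : pred I) (F : I -> C) v :
  (\sum_(i <- r | P i) F i) v = \sum_(i <- r | P i) F i v.
Proof. exact: (big_morph (fun f : C => f v)). Qed.

Program Definition lmul (a : D) : C := @Kend D K (fun v => a * v) _ _.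
Next Obligation. by move=> a v w /=; rewrite mulrDr. Qed.
Next Obligation. by move=> a v k _ /=; rewrite mulrA. Qed.

Lemma lmulB : {morph lmul : x y / x - y}.
Proof. by move=> x y; apply: kend_eq => v; rewrite kendBE /= mulrBl. Qed.

Lemma lmul_monoid : monoid_morphism lmul.
Proof.
split; first by apply: kend_eq => v /=; rewrite mul1r.
by move=> x y; apply: kend_eq => v; rewrite kendME /= mulrA.
Qed.

HB.instance Definition _ := GRing.isZmodMorphism.Build D C lmul lmulB.
HB.instance Definition _ := GRing.isMonoidMorphism.Build D C lmul lmul_monoid.

(** The value is 0 when right multiplication by [k] is not [K]-linear. *)
Definition rmul (k : D) : C :=
  if pselect (commutant K k) is left kc then
    @Kend D K (fun v => v * k) (fun v w => mulrDl v w k)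
      (fun v k' Kk' => etrans (esym (mulrA v k' k))
         (etrans (congr1 (fun x => v * x) (esym (kc k' Kk'))) (mulrA v k k')))
  else 0.

Lemma rmulE k v : commutant K k -> rmul k v = v * k.
Proof. by rewrite /rmul; case: pselect. Qed.

Lemma rmul_central k : K k -> commutant K k -> central (rmul k).
Proof.
move=> Kk kc f; apply: kend_eq => v.
by rewrite !kendME !rmulE // kfunM.
Qed.

Lemma lmul_central t : K t -> center D t -> central (lmul t).
Proof. by move=> Kt ct f; apply: kend_eq => v; rewrite !kendME /= !ct kfunM. Qed.

End KendRing.

(** * Transfer of the identity through central indeterminates *)

Section Transfer.

Definition node (R : nzRingType) (x : R) (u v : seq bool -> R) (l : seq bool) : R :=
  match l with [::] => x | true :: l' => u l' | false :: l' => v l' end.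

(** A single [u] supplies all variables, on disjoint sets of words, so that [node] can assemble it
    from assignments chosen separately for the two Lie words and for [rs]. *)
Definition capelli_identity (R : nzRingType) (a b : R) (s d : nat)
    (u : seq bool -> R) : R :=
  capelli (mkseq (fun j => u (false :: nseq j true)) d)
    (powers d (lie (lieword a b s (fun l => u (true :: true :: l)))
                   (lieword a b s (fun l => u (true :: false :: l))))).

Lemma capelli_identity_morph (R S : nzRingType) (f : {rmorphism R -> S}) a b s d u :
  f (capelli_identity a b s d u) = capelli_identity (f a) (f b) s d (f \o u).
Proof.
rewrite /capelli_identity capelli_morph powers_morph /lie rmorphB !rmorphM
  !lieword_morph.
by congr capelli; rewrite /mkseq -map_comp.
Qed.

Variables (D : unitRingType) (hD : division_ring D) (K : set D).
Hypotheses (hF : infinite_set (center D)) (FK : center D `<=` K)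
  (Kcomm : forall x y, K x -> K y -> x * y = y * x).
Variables (a b : D) (s d : nat).
Hypothesis idD : forall u, capelli_identity a b s d u = 0.
Local Notation C := (kend K).
Local Notation L := (lmul K).

(** An entry [(l, (x, c))] adds [L x * c] to the variable [l]; the list lets the factors [c] be
    treated one at a time. *)
Definition environment (u0 : seq bool -> D) (E : seq (seq bool * (D * C))) (l : seq
  bool) : C :=
  L (u0 l) + \sum_(e <- E | e.1 == l) L e.2.1 * e.2.2.

Lemma environment_cons u0 e E l :
  environment u0 (e :: E) l =
  environment u0 E l + (if e.1 == l then L e.2.1 * e.2.2 else 0).
Proof.
by rewrite /environment big_cons; case: ifP;
  rewrite ?addr0 // -addrA [_ + \sum_(_ <- _ | _) _]addrC.
Qed.

(** Once the central factor of the first entry is replaced by ['X], the identity becomes a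
    polynomial. It vanishes at [L t] for all central [t], by induction with [u0] shifted. As the
    center is infinite, it is zero, hence vanishes at the original factor. *)
Lemma transfer_environment E u0 :
    (forall e, e \in E -> central e.2.2) ->
  capelli_identity (L a) (L b) s d (environment u0 E) = 0.
Proof.
elim: E u0 => [|e E IH] u0 cE.
  have -> : environment u0 [::] = L \o u0.
    by apply: funext => l; rewrite /environment big_nil addr0.
  by rewrite -capelli_identity_morph idD rmorph0.
have cE' e' : e' \in E -> central e'.2.2 by move=> e'E; apply: cE;
  rewrite inE e'E orbT.
pose U l : {poly C} := (environment u0 E l)%:P
  + (if e.1 == l then (L e.2.1)%:P * 'X else 0).
pose p := capelli_identity (L a)%:P (L b)%:P s d U.
have evp (c : C) : central c -> p.[c] =
    capelli_identity (L a) (L b) s d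
      (fun l => environment u0 E l + (if e.1 == l then L e.2.1 * c else 0)).
  move=> cc; have cfu : commr_rmorph (@idfun C) c by move=> x; apply: cc.
  have -> : p.[c] = horner_morph cfu p by rewrite /horner_morph map_poly_id.
  rewrite /p capelli_identity_morph /= !horner_morphC /=; congr capelli_identity.
  apply: funext => l /=; rewrite rmorphD /= horner_morphC /=; congr (_ + _).
  by case: ifP; rewrite ?rmorph0 // rmorphM /= horner_morphC /= horner_morphX.
have p0 : p = 0.
  apply: (@central_roots_eq0 _ [set L t | t in center D]).
  - apply: contra_not hF => fin.
    apply: (@sub_finite_set _ _ (L @^-1` [set L t | t in center D])).
      by move=> t ct; exists t.
    apply: finite_preimage fin => x y _ _.
    by move=> /(congr1 (fun f : C => f 1)) /=; rewrite !mulr1.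
  - by move=> _ [t ct <-]; apply: lmul_central => //; apply: FK.
  - move=> _ _ [x cx <-] [y cy <-] xy; exists (L (x - y)^-1).
    rewrite -rmorphB -rmorphM div_mulrV ?rmorph1 // subr_eq0.
    by apply: contra_neq xy => ->.
  move=> _ [t ct <-]; rewrite evp; last by apply: lmul_central => //; apply: FK.
  rewrite -[RHS](IH (fun l => u0 l + (if e.1 == l then e.2.1 * t else 0)) cE').
  congr capelli_identity; apply: funext => l; rewrite /environment rmorphD /=.
  rewrite [RHS]addrAC; congr (_ + _).
  by case: ifP; rewrite ?rmorphM ?rmorph0.
have := evp e.2.2 (cE _ (mem_head _ _)); rewrite p0 horner0 => ->.
by congr capelli_identity; apply: funext => l; rewrite environment_cons.
Qed.

Definition koperator (x : C) := operator K x.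

(** Finitely supported environments with operator values, built as binary trees to match the shape
    of a Lie word. *)
Inductive finite_env : (seq bool -> C) -> Prop :=
| finite_env0 : finite_env (fun=> 0)
| finite_env_node x u v : koperator x -> finite_env u -> finite_env v ->
    finite_env (node x u v).

Lemma finite_environment u : finite_env u -> exists E,
  (forall e, e \in E -> central e.2.2) /\ u = environment (fun=> 0) E.
Proof.
elim=> [|x {}u v [l [lK xE]] _ [E [cE ->]] _ [E' [cE' ->]]].
  exists [::]; split=> //; apply: funext => l.
  by rewrite /environment big_nil rmorph0 addr0.
have Kc k : K k -> commutant K k by move=> Kk k'; apply: Kcomm.
exists ([seq ([::], (y.1, rmul K y.2)) | y <- l] ++
  ([seq (true :: e.1, e.2) | e <- E] ++ [seq (false :: e.1, e.2) | e <- E'])).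
split=> [e|].
  rewrite !mem_cat => /or3P[] /mapP[y yl ->] /=; last 2 first.
  - exact: cE.
  - exact: cE'.
  by apply: rmul_central; [|apply: Kc]; apply: lK.
apply: funext => w; rewrite /environment !big_cat !big_map /= rmorph0 add0r.
case: w => [|[] w] /=.
- rewrite [\sum_(i <- E | _) _]big_pred0 // [\sum_(i <- E' | _) _]big_pred0 // !addr0.
  apply: kend_eq => v'; rewrite xE kend_sumE;
    rewrite /opsum big_seq [RHS]big_seq_cond.
  under [RHS]eq_bigl => y do rewrite eqxx andbT.
  by apply: eq_bigr => y yl; rewrite kendME rmulE /= ?mulrA //; apply/Kc/lK.
- rewrite [\sum_(i <- l | _) _]big_pred0 // [\sum_(i <- E' | _) _]big_pred0 //
    add0r addr0.
  by rewrite ?add0r; apply: eq_bigl.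
- rewrite [\sum_(i <- l | _) _]big_pred0 // [\sum_(i <- E | _) _]big_pred0 // !add0r.
  by rewrite ?add0r; apply: eq_bigl.
Qed.

Lemma transfer u : finite_env u -> capelli_identity (L a) (L b) s d u = 0.
Proof. by move=> /finite_environment [E [cE ->]]; apply: transfer_environment. Qed.

End Transfer.

(** * Control of the operators *)

Section Control.

Variables (D : unitRingType) (hD : division_ring D) (K : set D).
Hypotheses (Kcomm : forall x y, K x -> K y -> x * y = y * x)
  (Kmax : forall c, commutant K c -> K c).
Variables a b : D.
Hypotheses (b_noncentral : ~ center D b) (infdim : forall W, exists z, ~ rspan K W z).
Local Notation C := (kend K).
Local Notation L := (lmul K).

Let K1 : K 1 := max1 Kmax.
Let KM x y : K x -> K y -> K (x * y) := @maxM D K Kcomm Kmax x y.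

Lemma kend_of_operator T : operator K T -> exists x : C, kfun x = T.
Proof.
move=> oT; have TD v w : T (v + w) = T v + T w by apply: operatorD oT.
have TM v k : K k -> T (v * k) = T v * k.
  by move=> Kk; apply: operatorMr oT _; apply: max_commutant Kk.
by exists (Kend TD TM).
Qed.

Lemma koperator_lmul c : koperator (L c).
Proof. exact: operator_mull K1 c. Qed.

Lemma koperatorM (x y : C) : koperator x -> koperator y -> koperator (x * y).
Proof. exact: operator_comp. Qed.

Lemma koperatorB (x y : C) : koperator x -> koperator y -> koperator (x - y).
Proof. by move=> ox oy; apply: operator_add ox _; apply: operator_opp. Qed.

Lemma koperator0 : koperator (0 : C).
Proof. by exists [::]; split=> // v; rewrite /opsum big_nil. Qed.

Lemma finite_env_koperator u l : finite_env u -> koperator (u l : C).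
Proof.
move=> fu; elim: fu l => [l|x {}u v ox _ ou _ ov [|[] l]] //; first exact: koperator0.
- exact: ou.
- exact: ov.
Qed.

Lemma koperator_lieword s (u : seq bool -> C) :
  (forall l, koperator (u l)) -> koperator (lieword (L a) (L b) s u).
Proof.
elim: s u => [|s IH] u ou /=; first exact: ou.
have oP := IH (fun l => u (true :: l)) (fun l => ou _).
have oQ := IH (fun l => u (false :: l)) (fun l => ou _).
have odP : koperator (ldelta (L a) (L b) (lieword (L a) (L b) s (fun l => u (true
  :: l)))).
  apply: koperatorB => //; apply: koperatorM; last exact: koperator_lmul.
  by apply: koperatorM => //; apply: koperator_lmul.
by apply: koperatorB; apply: koperatorM.
Qed.

(* The inner word [Q] moves a basis [y_i] of the span of [W] to fresh vectors
   [z_i]; the word [P] kills the [y_i], [b y_i] and [b z_i] and maps [z_i] to the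
   target, so only the term [P Q] of the bracket survives on [y_i]. *)
Lemma lieword_control s T (W : seq D) : operator K T -> exists u, finite_env u /\
  forall w, w \in W -> lieword (L a) (L b) s u w = T w.
Proof.
elim: s T W => [|s IH] T W oT.
  have [x Dx] := kend_of_operator oT; exists (node x (fun=> 0) (fun=> 0)).
  split=> [|w _ /=]; last by rewrite Dx.
  by apply: finite_env_node; [rewrite /koperator Dx|constructor|constructor].
have [n [y [dy cy]]] := rspan_basis hD K1 KM W.
pose Y := mkseq y n; pose bY := [seq b * v | v <- Y].
have [z dz] := fresh_density hD K1 KM b_noncentral infdim (Y ++ bY).
have [TP [oTP TPY TPz TPbz]] := dz n (fun i => T (y i)) (fun=> 0).
have [TQ [oTQ TQy]] := dy z.
have [uP [fP uPE]] := IH TP (Y ++ bY ++ mkseq z n ++ mkseq (fun i => b * z i) n) oTP.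
have [uQ [fQ uQE]] := IH TQ Y oTQ.
exists (node 0 uP uQ); split; first by apply: finite_env_node => //;
  apply: koperator0.
(* The difference is an operator, so it is enough that it vanish on the [y i], whose span contains
   [W]. *)
have oT' : operator K (fun v => lieword (L a) (L b) s.+1 (node 0 uP uQ) v - T v).
  apply: operator_add; last exact: operator_opp.
  by apply: koperator_lieword => l; apply: finite_env_koperator;
    apply: finite_env_node => //; apply: koperator0.
move=> w wW; apply/eqP; rewrite -subr_eq0; apply/eqP.
apply: (cy w wW _ oT') => v /mapP[i]; rewrite mem_iota add0n => /andP[_ lin] ->.
rewrite [lieword _ _ _ _]/= /lie /ldelta.
set P := lieword _ _ _ _ in uPE *; set Q := lieword _ _ _ _ in uQE *.
have yY : y i \in Y by apply: map_f; rewrite mem_iota.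
have byY : b * y i \in bY by apply: map_f.
have zi : z i \in mkseq z n by apply: map_f; rewrite mem_iota.
have bzi : b * z i \in mkseq (fun i => b * z i) n.
  by apply: (map_f (fun i => b * z i)); rewrite mem_iota.
rewrite kendBE !kendME !kendBE !kendME /= uQE // TQy //.
rewrite !uPE ?mem_cat ?yY ?byY ?zi ?bzi ?orbT // TPz // TPbz //.
rewrite !TPY ?mem_cat ?yY ?byY ?orbT // !mulr0 !subr0.
have Q0 : Q 0 = 0 by apply: operator0; apply: koperator_lieword => l;
  apply: finite_env_koperator.
by rewrite Q0 subr0 subrr.
Qed.

Lemma finite_env_spine (r : nat -> C) d : (forall i, koperator (r i)) ->
  exists u, finite_env u /\ forall i, (i < d)%N -> u (nseq i true) = r i.
Proof.
elim: d r => [|d IH] r kr; first by exists (fun=> 0); split=> //; constructor.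
have [u [fu ru]] := IH (fun i => r i.+1) (fun i => kr _).
exists (node (r 0%N) u (fun=> 0)); split; first by apply: finite_env_node => //;
  constructor.
by case=> //= i /ru.
Qed.

(** [r k] brings [z k] back to [z 0] and kills the other [z i], so for [i > k] the eliminated entry
    still sends [z 0] to [z i]. The last remaining entry sends [z 0] to [z d]. *)
Lemma capelli_shift (r : nat -> C) (z : nat -> D) d :
    (forall i j, (i <= d)%N -> r j (z i) = if i == j then z 0%N else 0) ->
  forall m k (E : nat -> C), (k + m)%N = d ->
    (forall i, (k <= i <= d)%N -> E i (z 0%N) = z i) ->
  capelli [seq r i | i <- iota k m] [seq E i | i <- iota k m.+1] (z 0%N) = z d.
Proof.
move=> rz; elim=> [|m IH] k E km Ez.
  by rewrite addn0 in km; rewrite /= Ez km ?leqnn.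
have kd : (k <= d)%N by rewrite -km leq_addr.
transitivity (capelli [seq r i | i <- iota k.+1 m]
  [seq E i * r k * E k - E k * r k * E i | i <- iota k.+1 m.+1] (z 0%N)).
  by rewrite /= -map_comp.
apply: (IH k.+1 (fun i => E i * r k * E k - E k * r k * E i));
  first by rewrite addSnnS.
move=> i /andP[ki id]; rewrite kendBE !kendME Ez ?leqnn // Ez ?id ?(ltnW ki) //.
rewrite !rz // eqxx gtn_eqF // Ez ?id ?(ltnW ki) //.
suff -> : E k 0 = 0 by rewrite subr0.
by apply/(addrI (E k 0)); rewrite -kfunD !addr0.
Qed.

(** [Q] sends [z i] to [b * z i], while [P] kills [z i] and sends [b * z i] to [z i.+1]. Thus
    [lie P Q] is a shift, its powers move [z 0] along the [z i], and [capelli] sends [z 0] to [z d],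
    which is nonzero. *)
Lemma capelli_identity_nontrivial s d : exists u : seq bool -> C,
  finite_env u /\ capelli_identity (L a) (L b) s d u <> 0.
Proof.
have [z dz] := fresh_density hD K1 KM b_noncentral infdim [::].
have [TQ [oTQ _ TQz _]] := dz d.+1 (fun i => b * z i) (fun=> 0).
have [TP [oTP _ TPz TPbz]] := dz d.+1 (fun=> 0) (fun i => z i.+1).
have [uP [fP uPE]] := lieword_control s (mkseq z d.+1 ++ mkseq (fun i => b * z i)
  d.+1) oTP.
have [uQ [fQ uQE]] := lieword_control s (mkseq z d.+1) oTQ.
have /choice [r rE] : forall j, exists x : C, koperator x /\
    forall i, (i <= d)%N -> x (z i) = if i == j then z 0%N else 0.
  move=> j.
  have [T [oT _ Tz _]] := dz d.+1 (fun i => if i == j then z 0%N else 0) (fun=> 0).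
  have [x Dx] := kend_of_operator oT; exists x; rewrite /koperator Dx.
  by split=> // i id; rewrite Tz.
have [uR [fR uRE]] := finite_env_spine d (fun j => (rE j).1).
exists (node 0 (node 0 uP uQ) uR); split.
  by apply: finite_env_node => //; [|apply: finite_env_node => //]; apply: koperator0.
rewrite /capelli_identity.
have -> : mkseq (fun j => node 0 (node 0 uP uQ) uR (false :: nseq j true)) d
   = [seq r i | i <- iota 0 d].
  by apply/eq_in_map => j; rewrite mem_iota => /andP[_ jd]; apply: uRE.
set P := lieword _ _ s _; set Q := lieword _ _ s _ => id0.
have lz i : (i < d)%N -> lie P Q (z i) = z i.+1.
  move=> id; have zi : z i \in mkseq z d.+1 by apply: map_f;
    rewrite mem_iota /= add0n ltnW.
  have bzi : b * z i \in mkseq (fun i => b * z i) d.+1.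
    by apply: (map_f (fun i => b * z i)); rewrite mem_iota /= add0n ltnW.
  have PE v : v \in mkseq z d.+1 ++ mkseq (fun i => b * z i) d.+1 -> P v = TP v by
    apply: uPE.
  have QE v : v \in mkseq z d.+1 -> Q v = TQ v by apply: uQE.
  have Q0 : Q 0 = 0.
    by apply: operator0; apply: koperator_lieword => l;
      apply: (finite_env_koperator l fQ).
  have id' : (i < d.+1)%N by apply: ltnW.
  rewrite /lie kendBE !kendME QE // TQz // !PE ?mem_cat ?zi ?bzi ?orbT //.
  by rewrite TPz // TPbz // Q0 subr0.
have pz i : (0 <= i <= d)%N -> (lie P Q ^+ i) (z 0%N) = z i.
  elim: i => [_ //|i IH] id; rewrite exprS kendME IH ?lz //; exact: ltnW.
have := capelli_shift (fun i j => (rE j).2 i) (add0n d) pz.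
rewrite -/(powers d (lie P Q)) id0 => zd.
have [T [oT _ Tz _]] := dz d.+1 (fun=> 1) (fun=> 0).
have := Tz d (ltnSn d); rewrite -zd (operator0 oT) => /eqP.
by rewrite eq_sym oner_eq0.
Qed.

End Control.

(** * The ultrafilter and the conclusion *)

Lemma nonprincipal_ultrafilter (T : Type) (A : set T) : infinite_set A ->
  exists U : set_system T, [/\ UltraFilter U, U A
    & forall B, finite_set B -> U (~` B)].
Proof.
move=> infA; pose F : set_system T := [set B | finite_set (A `\` B)].
have FF : ProperFilter F.
  split.
  - by rewrite /F /= setD0.
  split.
  - by rewrite /F /= setDT.
  - move=> B C FB FC; by rewrite /F /= setDIr finite_setU.
  - move=> B C BC; apply: sub_finite_set; exact: setDS.
have [U [UU FU]] := ultraFilterLemma FF.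
exists U; split=> // [|B finB]; apply: FU; rewrite /F /=.
- by rewrite setDv.
- by rewrite setDE setCK; apply: sub_finite_set finB => x [].
Qed.

Theorem corollary1p4 (D : unitRingType) (hD : division_ring D)
    (hF : infinite_set (center D))
    (N : set D) (hN : almost_subnormal (unit_group D) N)
    (hNc : ~ N `<=` center D)
    (halg : exists d : nat, (0 < d)%N /\
       forall x y : D, N x -> N y ->
         exists n : nat, (n <= d)%N /\ algebraic_of_degree (x * y - y * x) n) :
  centrally_finite D.
Proof.
have [d [_ algN]] := halg.
have [a Na nca] : exists2 a, N a & ~ center D a.
  by apply: contrapT => h; apply: hNc => a Na; apply: contrapT => nca; apply: h;
    exists a.
have [U [UU UZ Ucofin]] := nonprincipal_ultrafilter hF.
have [s lead] := leading_lieword hD UU UZ Ucofin hN Na.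
have idD u : capelli_identity a a^-1 s d u = 0.
  by apply: (capelli_lieword hD UU UZ Ucofin algN); rewrite ?size_mkseq.
have [K [Kcomm Kmax]] := maximal_commuting D.
apply: contrapT => ninf.
(* Finite dimension over [K] would descend to the center. *)
have infdim W : exists z, ~ rspan K W z.
  apply/existsNP => clW; apply: ninf;
    exact: (finite_centrally_finite hD Kcomm Kmax clW).
have ncb : ~ center D a^-1.
  by move=> /(centerV hD); rewrite invrK.
have [u [fu]] := capelli_identity_nontrivial hD Kcomm Kmax a ncb infdim s d.
apply; apply: (transfer hD hF _ Kcomm idD fu).
exact: max_center Kmax.
Qed.
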